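(* Let $G$ be a countable, discrete group with identity $e$, and let $\varphi:G\to\mathbb{R}$ be a symmetric function. Then $\|e^{-t\varphi}\|_{B_2}\leq 1$ for every $t>0$ if and only if $\varphi$ splits as $$\varphi(y^{-1}x)=\psi(x,y)+\theta(x,y)+\theta(e,e)\qquad (x,y\in G),$$ where $\psi$ is a conditionally negative definite kernel on $G$ vanishing on the diagonal, and $\theta$ is a bounded, positive definite kernel on $G$.
   Context: A kernel on a non-empty set $X$ is a function $k:X\times X\to\mathbb{C}$. It is hermitian if $k(y,x)=\overline{k(x,y)}$; positive definite if $\sum_{i,j} c_i\overline{c_j}k(x_i,x_j)\geq 0$ for all finite families $x_i\in X$, $c_i\in\mathbb{C}$; conditionally negative definite if it is hermitian and $\sum_{i,j}c_i\overline{c_j}k(x_i,x_j)\leq 0$ for all finite families $x_i\in X$, $c_i\in\mathbb{C}$ with $\sum_i c_i=0$. A function $\varphi$ on $G$ is symmetric if $\varphi(x^{-1})=\varphi(x)$ for all $x\in G$. A kernel $k$ on $X$ is a Schur multiplier if for every bounded operator $A=[a_{xy}]_{x,y\in X}$ on $\ell^2(X)$ the matrix $[k(x,y)a_{xy}]$ represents a bounded operator $m_k(A)$ on $\ell^2(X)$; then $\|k\|_S=\|m_k\|$. A function $\varphi:G\to\mathbb{C}$ is a Herz-Schur multiplier if $\hat\varphi(x,y)=\varphi(y^{-1}x)$ is a Schur multiplier on $G$, and $\|\varphi\|_{B_2}=\|\hat\varphi\|_S$. The inequality $\|\varphi\|_{B_2}\le 1$ includes the assertion that $\varphi$ is a Herz-Schur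 multiplier. *)

(* Defs.v *)
From HB Require Import structures.
From mathcomp Require Import all_boot all_order all_algebra.
From mathcomp Require Import complex ring.
From mathcomp Require Import all_classical all_reals all_analysis.

Set Implicit Arguments.
Unset Strict Implicit.
Unset Printing Implicit Defensive.

Import Order.TTheory GRing.Theory Num.Theory.
Import Normc.

Local Open Scope classical_set_scope.
Local Open Scope ring_scope.
Local Open Scope complex_scope.

Section Ell2.
Variables (R : realType) (X : choiceType).
Implicit Types f g : X -> R[i].

Definition sqsum f : \bar R := (\esum_(x in [set: X]) (normc (f x) ^+ 2)%:E)%E.

Definition ell2_pred : {pred X -> R[i]} := fun f => `[< (sqsum f < +oo)%E >].

Lemma sqsum_ge0 f : (0 <= sqsum f)%E.
Proof. by apply: esum_ge0 => x _; rewrite lee_fin sqr_ge0. Qed.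

Lemma sqsum0 : sqsum 0 = 0%E.
Proof. by apply: esum1 => x _; rewrite normc0 expr0n. Qed.

Lemma normc_ge0 (z : R[i]) : 0 <= normc z.
Proof. by case: z => a b; rewrite /normc sqrtr_ge0. Qed.

Lemma sqsum_lin (a : R[i]) f g : (sqsum f < +oo)%E -> (sqsum g < +oo)%E ->
  (sqsum (a *: f + g)%R < +oo)%E.
Proof.
move=> hf hg.
pose A := 2 * normc a ^+ 2.
have A0 : 0 <= A by rewrite mulr_ge0// sqr_ge0.
have sum0 (c : R) h : 0 <= c -> (sqsum h < +oo)%E ->
    (\esum_(x in [set: X]) (c * normc (h x) ^+ 2)%:E < +oo)%E.
  move=> c0 hh; apply: (@le_lt_trans _ _ (c%:E * sqsum h)%E); last first.
    by rewrite lte_mul_pinfty.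
  apply: ge_ereal_sup => _ [F [finF _] <-].
  have -> : (\sum_(i \in F) (c * normc (h i) ^+ 2)%:E =
             c%:E * \sum_(i \in F) (normc (h i) ^+ 2)%:E)%E.
    rewrite !fsbig_finite//= ge0_sume_distrr; last first.
      by move=> i _; rewrite lee_fin sqr_ge0.
    by apply: eq_bigr => i _; rewrite EFinM.
  apply: lee_wpmul2l; first by rewrite lee_fin.
  by apply: esum_ge; exists F.
have hs : (\esum_(x in [set: X]) ((A * normc (f x) ^+ 2)%:E +
            (2 * normc (g x) ^+ 2)%:E) < +oo)%E.
  rewrite esumD; last 2 first.
  - by move=> x _; rewrite lee_fin mulr_ge0// sqr_ge0.
  - by move=> x _; rewrite lee_fin mulr_ge0// sqr_ge0.
  by rewrite lte_add_pinfty// sum0.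
apply: le_lt_trans hs; apply: le_esum => x _.
rewrite -EFinD lee_fin.
have h1 : normc ((a *: f + g) x) <= normc a * normc (f x) + normc (g x).
  have -> : (a *: f + g) x = a * f x + g x by [].
  by rewrite -normcM; exact: le_normcD.
apply: (@le_trans _ _ ((normc a * normc (f x) + normc (g x)) ^+ 2)).
  by rewrite lerXn2r// nnegrE ?addr_ge0 ?mulr_ge0// normc_ge0.
rewrite /A -mulrA -exprMn; set u := _ * _; set v := normc _.
rewrite -subr_ge0 (_ : _ - _ = (u - v) ^+ 2) ?sqr_ge0//.
by rewrite sqrrB sqrrD !mulr2n; ring.
Qed.

Fact ell2_submod_closed : submod_closed ell2_pred.
Proof.
split; first by apply/asboolP; rewrite sqsum0 ltry.
move=> a f g /asboolP hf /asboolP hg; apply/asboolP.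
exact: sqsum_lin.
Qed.

HB.instance Definition _ :=
  GRing.isSubmodClosed.Build R[i] (X -> R[i]) ell2_pred ell2_submod_closed.

Record ell2 := Ell2 { ell2_fun :> X -> R[i]; _ : ell2_fun \in ell2_pred }.

HB.instance Definition _ := [isSub for ell2_fun].
HB.instance Definition _ := [Choice of ell2 by <:].
HB.instance Definition _ := [SubChoice_isSubLmodule of ell2 by <:].

Definition norm2 (v : ell2) : R := Num.sqrt (fine (sqsum v)).

Definition delta_fun (y : X) : X -> R[i] := fun x => (x == y)%:R.

Fact delta_subproof y : delta_fun y \in ell2_pred.
Proof.
apply/asboolP; rewrite /sqsum /delta_fun.
rewrite (esumID [set y]); last by move=> x _; rewrite lee_fin sqr_ge0.
rewrite setTI esum_set1 ?lee_fin ?sqr_ge0// esum1 ?adde0 ?ltry//.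
by move=> x [_ /= /eqP /negbTE ->]; rewrite normc0 expr0n.
Qed.

Definition delta (y : X) : ell2 := Ell2 (delta_subproof y).

End Ell2.

Section Operators.
Variables (R : realType) (X : choiceType).
Implicit Types (A B : {linear ell2 R X -> ell2 R X}).

Definition bounded_op A := exists M : R, forall v, norm2 (A v) <= M * norm2 v.

Definition opnorm A : \bar R :=
  ereal_sup [set (norm2 (A v))%:E | v in [set v | norm2 v <= 1]].

(* a_xy = <A delta_y, delta_x>, the coordinate at x of A delta_y *)
Definition op_matrix A (x y : X) : R[i] := A (delta R y) x.

End Operators.

Section Kernels.
Variables (R : realType) (X : choiceType).
Implicit Types k : X -> X -> R[i].

Definition hermitian_kernel k := forall x y, k y x = (k x y)^*%C.

(* in R[i], the order 0 <= z means that z is real and nonnegative *)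
Definition positive_definite k :=
  forall (n : nat) (x : 'I_n -> X) (c : 'I_n -> R[i]),
    0 <= \sum_(i < n) \sum_(j < n) c i * (c j)^*%C * k (x i) (x j).

Definition conditionally_negative_definite k :=
  hermitian_kernel k /\
  forall (n : nat) (x : 'I_n -> X) (c : 'I_n -> R[i]),
    \sum_(i < n) c i = 0 ->
    \sum_(i < n) \sum_(j < n) c i * (c j)^*%C * k (x i) (x j) <= 0.

Definition bounded_kernel k := exists M : R, forall x y, normc (k x y) <= M.

(* B = m_k(A); B is determined by A since a bounded operator is determined by
   its matrix *)
Definition schur_image k (A B : {linear ell2 R X -> ell2 R X}) :=
  bounded_op B /\ forall x y, op_matrix B x y = k x y * op_matrix A x y.

Definition schur_multiplier k :=
  forall A : {linear ell2 R X -> ell2 R X}, bounded_op A ->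
    exists B : {linear ell2 R X -> ell2 R X}, schur_image k A B.

(* the operator norm of m_k: sup of |m_k(A)| over the bounded A with |A| <= 1 *)
Definition schur_norm k : \bar R :=
  ereal_sup [set s | exists A B : {linear ell2 R X -> ell2 R X},
    [/\ bounded_op A, (opnorm A <= 1)%E, schur_image k A B & s = opnorm B]].

End Kernels.

Section HerzSchur.
Variables (R : realType) (G : groupType).
Implicit Types phi : G -> R[i].

Definition group_kernel phi (x y : G) : R[i] := phi (y^-1 * x)%g.

Definition herz_schur_multiplier phi := schur_multiplier (group_kernel phi).

Definition B2_norm phi : \bar R := schur_norm (group_kernel phi).

(* the inequality |phi|_{B_2} <= c, which asserts membership in B_2 *)
Definition B2_norm_le phi (c : \bar R) :=
  herz_schur_multiplier phi /\ (B2_norm phi <= c)%E.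

Definition symmetric_fun (phi : G -> R) := forall x, phi (x^-1)%g = phi x.

End HerzSchur.

(* Main.v *)
Require Import Defs.
From HB Require Import structures.
From mathcomp Require Import all_boot all_order all_algebra.
From mathcomp Require Import complex ring lra.
From mathcomp Require Import all_classical all_reals all_analysis.

(** Write k(x, y) = phi(y^-1 x), a real symmetric kernel; all kernels below can
be taken real, because phi is.

From a contractive semigroup to a splitting.  Call B_xx + B_yy + 2 B_xy + p_xy
[splitting p B], where p is conditionally negative definite with zero diagonal
and B is positive definite; in Hilbert space terms it is
|R(x) - R(y)|^2 + |S(x) + S(y)|^2.  On a finite set these kernels form a convex
cone.  If k were not in its closure, a symmetric W would satisfy <W, k> < 0 while
being nonnegative on the cone.  Testing W on the generators (u_x - u_y)^2 and
(u_x + u_y)^2 gives |u^T W u| <= sum_x w_x u_x^2, with w_x the row sums of W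
([balanced]), so that W_xy / sqrt(w_x w_y) is the matrix of a contraction A.  Since
e^{-tk} is a contractive Schur multiplier, pairing m(A) with the vector sqrt(w)
gives <W, e^{-tk}> <= sum_x w_x = <W, 1> ([schur_pairing]); dividing by t and
letting t tend to 0 gives <W, k> >= 0, a contradiction
([balanced_pairing_ge0], [finite_splitting]).  The splittings found on larger and
larger finite sets, with smaller and smaller errors, are bounded at each pair of
points, so they converge along an ultrafilter ([splitting_limit]).  On the
diagonal 4 B_xx = phi(e), whence B_xx + B_yy = theta(e, e) for theta = 2B.

From a splitting to a contractive semigroup.  On a finite set, positive definite
kernels are Gram kernels ([real_pd_gram]), and a kernel sum_i f_i(x) g_i(y) has
Schur norm at most the bound on sum_i f_i^2 and sum_i g_i^2
([schur_le_factor]).  With c = theta(e, e), g(x) = psi(x, e) + c / 2 and the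
positive definite kernel K(x, y) = psi(x, e) + psi(e, y) - psi(x, y), the kernel
(1 - t g(x)) (1 - t g(y)) + t K(x, y) - t theta(x, y) equals 1 - t k + O(t^2), and
its factorization has squared norms 1 + t^2 g(x)^2: the terms of order t cancel
because psi vanishes and theta is equal to c on the diagonal
([schur_le_generator]).  So e^{-tk} has finite-set Schur norm at most 1 + C t^2 for
small t, and e^{-tk} = (e^{-(t/n)k})^n has Schur norm at most
(1 + C t^2 / n^2)^n, which tends to 1 ([schur_le_semigroup]).

Passing between finite sets and operators.  A matrix whose finite blocks are
uniformly bounded defines a bounded operator, whose rows are ultralimits of
finite sums ([matrix_operator]); and a bounded operator is bounded by its finite
blocks, because finitely supported vectors are dense
([operator_le_of_matrix]). *)

Set Implicit Arguments.
Unset Strict Implicit.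
Unset Printing Implicit Defensive.

Import Order.TTheory GRing.Theory Num.Theory.
Import numFieldNormedType.Exports.
Import Normc.

Local Open Scope classical_set_scope.
Local Open Scope ring_scope.
Local Open Scope complex_scope.

Local Notation Re := (@complex.Re _).
Local Notation Im := (@complex.Im _).

(** * Limits along a free ultrafilter *)

(** Every bounded real sequence converges along this ultrafilter, so that limits
can be taken at all points of an infinite set at once, without extracting
subsequences. *)
Definition free_ultra : set_system nat :=
  sval (cid (ultraFilterLemma eventually_filter)).

#[global] Instance free_ultra_ultra : UltraFilter free_ultra.
Proof. by have [] := svalP (cid (ultraFilterLemma eventually_filter)). Qed.

#[global] Instance free_ultra_proper : ProperFilter free_ultra.
Proof. exact: ultra_proper. Qed.

Lemma near_free_ultra (P : nat -> Prop) :
  (\forall n \near \oo, P n) -> \forall n \near free_ultra, P n.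
Proof.
by have [_] := svalP (cid (ultraFilterLemma eventually_filter)); apply.
Qed.

Definition ulim (R : realType) (u : nat -> R) : R := lim (u @ free_ultra).

(** A cluster point exists by compactness; an ultrafilter that clusters at a point
converges to it. *)
Lemma cvg_ulim (R : realType) (u : nat -> R) (M : R) :
  (\forall n \near \oo, `|u n| <= M) -> u @ free_ultra --> ulim u.
Proof.
move=> uM; have cpt : compact `[- M, M]%classic := @segment_compact R (- M) M.
have uF : (u @ free_ultra) `[- M, M]%classic.
  apply: near_free_ultra; apply: filterS uM => n /=.
  by rewrite in_itv /= -ler_norml.
have [p [_ clp]] := cpt (u @ free_ultra) _ uF.
apply/cvg_ex; exists p => A pA.
have [//|FnA] := in_ultra_setVsetC (u @^-1` A) free_ultra_ultra.
by have [x []] := clp (~` A) A FnA pA.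
Qed.

Lemma cvg_bsum (R : realType) (I : eqType) (F : set_system nat) (r : seq I)
    (f : I -> nat -> R) (l : I -> R) : Filter F ->
  (forall i, i \in r -> f i @ F --> l i) ->
  (\sum_(i <- r) f i n) @[n --> F] --> \sum_(i <- r) l i.
Proof.
move=> FF; elim: r => [|i r IH] fl.
  under eq_fun do rewrite big_nil.
  by rewrite big_nil; exact: cvg_cst.
under eq_fun do rewrite big_cons.
rewrite big_cons; apply: cvgD; first by apply: fl; rewrite mem_head.
by apply: IH => j jr; apply: fl; rewrite in_cons jr orbT.
Qed.

(** * Separation of a point from a convex cone *)

(** First-order condition for a minimum at the end point 0 of [0, 1]. *)
Lemma linear_ge0_of_quadratic (R : realType) (a b : R) :
  (forall s, 0 < s <= 1 -> 0 <= s * a + s ^+ 2 * b) -> 0 <= a.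
Proof.
move=> h; rewrite leNgt; apply/negP => a0.
(* this s lies in (0, 1) and makes a + s * |b| negative *)
pose s := - a / (- a + 1 + `|b|).
have b0 := normr_ge0 b.
have D0 : 0 < - a + 1 + `|b| by lra.
have s01 : 0 < s <= 1.
  by rewrite /s divr_gt0 ?oppr_gt0 //= ler_pdivrMr //; lra.
have := h s s01; case/andP: s01 => s0 s1.
have -> : s * a + s ^+ 2 * b = s * (a + s * b) by ring.
rewrite pmulr_rge0 // => h2.
have : s * b <= s * `|b| by rewrite ler_pM2l ?ler_norm.
have : s * (- a + 1 + `|b|) = - a by rewrite /s divfK ?gt_eqF.
have : 0 < s * - a by rewrite mulr_gt0 ?oppr_gt0.
rewrite !mulrDr mulr1; lra.
Qed.

Section Separation.
Variables (R : realType) (I : eqType) (r : seq I).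
Implicit Types (q w z : I -> R).

Let dot (q w : I -> R) : R := \sum_(i <- r) q i * w i.

Lemma dot_sq_line q w c s :
  dot (fun i => q i + s * w i - c i) (fun i => q i + s * w i - c i) =
  dot (fun i => q i - c i) (fun i => q i - c i)
   + s * (2 * dot w (fun i => q i - c i)) + s ^+ 2 * dot w w.
Proof.
rewrite /dot !mulr_sumr -!big_split /=; apply: eq_bigr => i _; ring.
Qed.

(** Let d > 0 be the squared distance from z to the cone.  A minimizing sequence is
bounded, so it has an ultralimit q, a nearest point of the closure.  Moving
from q in a direction of the cone, or from q towards 0, cannot decrease the
distance; the two first-order conditions say that w = q - z is nonnegative on the
cone and that <q, w> <= 0, so <z, w> <= - |w|^2 < 0. *)
Lemma cone_separation (Q : set (I -> R)) z :
  Q (fun=> 0) ->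
  (forall q q', Q q -> Q q' -> Q (fun i => q i + q' i)) ->
  (forall (s : R) q, 0 <= s -> Q q -> Q (fun i => s * q i)) ->
  (forall e : R, 0 < e -> exists2 q, Q q & \sum_(i <- r) (q i - z i) ^+ 2 <= e) \/
  (exists2 w, (forall q, Q q -> 0 <= \sum_(i <- r) q i * w i) &
     \sum_(i <- r) z i * w i < 0).
Proof.
move=> Q0 QD QZ.
pose D q := dot (fun i => q i - z i) (fun i => q i - z i).
have DE q : D q = \sum_(i <- r) (q i - z i) ^+ 2 by [].
case: (pselect (forall e : R, 0 < e -> exists2 q, Q q & D q <= e)) => [h|h];
  first by left.
right; move/existsNP: h => [e /not_implyP[e0 he]].
have De q : Q q -> e < D q.
  by move=> Qq; rewrite ltNge; apply/negP => qe; apply: he; exists q.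
pose d := inf [set D q | q in Q].
have hasinf : has_inf [set D q | q in Q].
  split; first by exists (D (fun=> 0)); exists (fun=> 0).
  by exists e => _ [q Qq <-]; exact/ltW/De.
have dle q : Q q -> d <= D q.
  by move=> Qq; apply: ge_inf; [case: hasinf | exists q].
have d0 : 0 < d.
  apply: (lt_le_trans e0); apply: lb_le_inf; first by case: hasinf.
  by move=> _ [q Qq <-]; exact/ltW/De.
have /choice[qn qnP] : forall n : nat, exists q, Q q /\ D q < d + n.+1%:R^-1.
  move=> n; have : (0 : R) < n.+1%:R^-1 by rewrite invr_gt0 ltr0n.
  by move=> n0; have [_ [q Qq <-] ?] := inf_adherent n0 hasinf; exists q.
pose q i := ulim (fun n => qn n i).
have cvq i : i \in r -> qn n i @[n --> free_ultra] --> q i.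
  move=> ir; apply: (@cvg_ulim _ _ (d + 2 + `|z i|)).
  apply: nearW => n; have [_ Dn] := qnP n.
  have n1 : (n.+1%:R : R)^-1 <= 1 by rewrite invf_le1 ?ltr0n // ler1n.
  have hi : (qn n i - z i) ^+ 2 <= D (qn n).
    rewrite DE (big_rem i) //= lerDl; apply: sumr_ge0 => j _; exact: sqr_ge0.
  have : `|qn n i - z i| <= d + 2.
    rewrite -(@ler_pXn2r _ 2) ?nnegrE ?normr_ge0 //; last by lra.
    rewrite -normrX ger0_norm ?sqr_ge0 //.
    have -> : (d + 2) ^+ 2 = d ^+ 2 + 4 * d + 4 by ring.
    apply: (le_trans hi); apply: (le_trans (ltW Dn)).
    apply: (le_trans (lerD (lexx d) n1)); have := sqr_ge0 d; lra.
  have := ler_normD (qn n i - z i) (z i); rewrite subrK; lra.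
have cvD (f : nat -> I -> R) (g : I -> R) :
    (forall i, i \in r -> f n i @[n --> free_ultra] --> g i) ->
    D (f n) @[n --> free_ultra] --> D g.
  move=> fg; apply: cvg_bsum => i ir.
  by apply: cvgM; apply: cvgB; (exact: fg || exact: cvg_cst).
have Dq : D q <= d.
  have cvd : d + n.+1%:R^-1 @[n --> free_ultra] --> d.
    rewrite -[X in _ --> X]addr0; apply: cvgD; first exact: cvg_cst.
    apply: cvg_trans (@cvg_harmonic R).
    by move=> A; exact: near_free_ultra.
  apply: (ler_cvg_to (cvD _ _ cvq) cvd).
  by apply: nearW => n; have [_ /ltW] := qnP n.
have Dge s q' : Q q' -> 0 <= s -> d <= D (fun i => q i + s * q' i).
  move=> Qq' s0.
  have cv : D (fun i => qn n i + s * q' i) @[n --> free_ultra] -->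
            D (fun i => q i + s * q' i).
    apply: (cvD (fun n i => qn n i + s * q' i)) => i ir.
    by apply: cvgD; [exact: cvq | exact: cvg_cst].
  apply: (cvgr_to_ge cv); apply: nearW => n; apply: dle; apply: QD; last exact: QZ.
  by have [] := qnP n.
have Dge' s : 0 <= s <= 1 -> d <= D (fun i => q i + s * - q i).
  move=> /andP[s0 s1].
  have cv : D (fun i => qn n i + s * - qn n i) @[n --> free_ultra] -->
            D (fun i => q i + s * - q i).
    apply: (cvD (fun n i => qn n i + s * - qn n i)) => i ir.
    apply: cvgD; first exact: cvq.
    by apply: cvgM; [exact: cvg_cst | apply: cvgN; exact: cvq].
  apply: (cvgr_to_ge cv); apply: nearW => n; apply: dle.
  rewrite (_ : (fun i => _) = (fun i => (1 - s) * qn n i)).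
    by apply: QZ; [rewrite subr_ge0 | have [] := qnP n].
  by apply/funext => i; ring.
pose w i := q i - z i.
have Dq' : D q = d.
  apply/eqP; rewrite eq_le Dq /=.
  have -> : q = fun i => q i + 0 * 0 by apply/funext => i; ring.
  exact: Dge.
exists w => [q' Qq'|].
  rewrite -/(dot q' w).
  suff : 0 <= 2 * dot q' w by rewrite pmulr_rge0.
  apply: (@linear_ge0_of_quadratic _ _ (dot q' q')) => s /andP[s0 s1].
  have := Dge s q' Qq' (ltW s0).
  by rewrite /D dot_sq_line -/(D q) Dq' -addrA lerDl.
have qw : dot q w <= 0.
  suff : 0 <= 2 * dot (fun i => - q i) w.
    rewrite pmulr_rge0 // /dot.
    under eq_bigr do rewrite mulNr.
    by rewrite sumrN oppr_ge0.
  apply: (@linear_ge0_of_quadratic _ _ (dot (fun i => - q i) (fun i => - q i))).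
  move=> s /andP[s0 s1].
  have := Dge' s; rewrite (ltW s0) s1 => /(_ erefl).
  by rewrite /D dot_sq_line -/(D q) Dq' -addrA lerDl.
have -> : \sum_(i <- r) z i * w i = dot q w - D q.
  by rewrite /dot DE -sumrB; apply: eq_bigr => i _; rewrite /w; ring.
by rewrite Dq' -subr_gt0 sub0r opprB subr_gt0; apply: le_lt_trans d0.
Qed.

End Separation.

(** * Finite sums and complex numbers *)

Lemma ler_sum_uniq (R : realType) (I : eqType) (s t : seq I) (f : I -> R) :
  uniq s -> uniq t -> {subset s <= t} -> (forall i, 0 <= f i) ->
  \sum_(i <- s) f i <= \sum_(i <- t) f i.
Proof.
elim: s t => [|x s IH] t; first by move=> *; rewrite big_nil sumr_ge0.
move=> /= /andP[xs us] ut st f0; rewrite big_cons [leRHS](big_rem x) /=; last first.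
  by apply: st; rewrite mem_head.
rewrite lerD2l; apply: IH => //; first exact: rem_uniq.
move=> y ys; rewrite mem_rem_uniq // inE /=; apply/andP; split.
  by apply: contraNneq xs => <-.
by apply: st; rewrite in_cons ys orbT.
Qed.

Lemma big_uniq_support (R : pzSemiRingType) (I : eqType) (s t : seq I) (f : I -> R) :
  uniq s -> uniq t -> (forall i, i \notin s -> f i = 0) ->
  \sum_(i <- t) f i = \sum_(i <- s | i \in t) f i.
Proof.
move=> us ut f0.
rewrite [LHS](bigID (mem s)) /= [X in _ + X]big1 ?addr0; last first.
  by move=> i; exact: f0.
rewrite -big_filter -[RHS]big_filter; apply: perm_big.
apply: uniq_perm; rewrite ?filter_uniq // => i.
by rewrite !mem_filter andbC.
Qed.

Lemma big_seq_support1 (V : nmodType) (I : eqType) (s : seq I) (f : I -> V) x :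
  uniq s -> x \in s -> (forall y, y != x -> f y = 0) -> \sum_(y <- s) f y = f x.
Proof. by move=> us xs f0; rewrite (bigD1_seq x) //= big1 ?addr0. Qed.

Section ComplexParts.
Variable R : realType.
Implicit Types z w : R[i].

Lemma Re_mul z w : Re (z * w) = Re z * Re w - Im z * Im w.
Proof. by case: z => a b; case: w => c d; simpc. Qed.

Lemma Im_mul z w : Im (z * w) = Re z * Im w + Im z * Re w.
Proof. by case: z => a b; case: w => c d; simpc. Qed.

Lemma Re_add z w : Re (z + w) = Re z + Re w.
Proof. by case: z => a b; case: w => c d; simpc. Qed.

Lemma Im_add z w : Im (z + w) = Im z + Im w.
Proof. by case: z => a b; case: w => c d; simpc. Qed.

Lemma Re_opp z : Re (- z) = - Re z. Proof. by case: z. Qed.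

Lemma Im_opp z : Im (- z) = - Im z. Proof. by case: z. Qed.

Lemma Re_sum I (r : seq I) (P : pred I) (f : I -> R[i]) :
  Re (\sum_(i <- r | P i) f i) = \sum_(i <- r | P i) Re (f i).
Proof. by apply: (big_morph (@complex.Re R)) => // z w; exact: Re_add. Qed.

Lemma Im_sum I (r : seq I) (P : pred I) (f : I -> R[i]) :
  Im (\sum_(i <- r | P i) f i) = \sum_(i <- r | P i) Im (f i).
Proof. by apply: (big_morph (@complex.Im R)) => // z w; exact: Im_add. Qed.

Lemma complex_eqP z w : Re z = Re w -> Im z = Im w -> z = w.
Proof. by case: z => a b; case: w => c d /= -> ->. Qed.

Lemma Re_realM (c : R) z : Re (c%:C * z) = c * Re z.
Proof. by case: z => a b; simpc. Qed.

Definition nsq z : R := Re z ^+ 2 + Im z ^+ 2.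

Lemma nsq_ge0 z : 0 <= nsq z.
Proof. by rewrite addr_ge0 ?sqr_ge0. Qed.

Lemma normc_sq z : normc z ^+ 2 = nsq z.
Proof. by case: z => a b; rewrite /normc sqr_sqrtr // addr_ge0 ?sqr_ge0. Qed.

Lemma nsqM z w : nsq (z * w) = nsq z * nsq w.
Proof. by rewrite /nsq Re_mul Im_mul; ring. Qed.

Lemma nsq_real (x : R) : nsq x%:C = x ^+ 2.
Proof. by rewrite /nsq /= expr0n addr0. Qed.

Lemma nsq0 : nsq 0 = 0.
Proof. by rewrite nsq_real expr0n. Qed.

Lemma nsqN z : nsq (- z) = nsq z.
Proof. by rewrite /nsq Re_opp Im_opp !sqrrN. Qed.

End ComplexParts.

(** * Bounded bilinear forms on finite sets *)

Section Forms.
Variables (R : realType) (X : eqType).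
Implicit Types (s : seq X) (a : X -> X -> R[i]) (u v : X -> R[i]) (M : R).

Definition bform s a u v : R[i] := \sum_(x <- s) \sum_(y <- s) a x y * u y * v x.

Definition l2sq s u : R := \sum_(x <- s) nsq (u x).

(** When s has no repetitions, homogeneity in u and v shows that this is the bound
M on the operator norm of the block of a on s.  The arithmetic mean of the squared norms replaces the product of
the norms, and the real part replaces the modulus, so that such bounds can be
added without the Cauchy-Schwarz inequality. *)
Definition form_le s a M := forall u v,
  Re (bform s a u v) <= M / 2 * (l2sq s u + l2sq s v).

Lemma l2sq_ge0 s u : 0 <= l2sq s u.
Proof. by apply: sumr_ge0 => x _; exact: nsq_ge0. Qed.

Lemma l2sqZ s (c : R) u : l2sq s (fun x => c%:C * u x) = c ^+ 2 * l2sq s u.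
Proof.
by rewrite /l2sq mulr_sumr; apply: eq_bigr => x _; rewrite nsqM nsq_real.
Qed.

Lemma bform_rows s a u v :
  bform s a u v = \sum_(x <- s) (\sum_(y <- s) a x y * u y) * v x.
Proof. by apply: eq_bigr => x _; rewrite mulr_suml. Qed.

Lemma Re_conj_mul (z : R[i]) (c : R) :
  Re (z * (c%:C * z^*%C)) = c * nsq z.
Proof. by case: z => p q; simpc; rewrite /nsq /=; ring. Qed.

(** Test the form with v = M^-1 * conj(a u). *)
Lemma form_le_rows s a M u : 0 < M -> form_le s a M ->
  \sum_(x <- s) nsq (\sum_(y <- s) a x y * u y) <= M ^+ 2 * l2sq s u.
Proof.
move=> M0 aM; set w := fun x => \sum_(y <- s) a x y * u y.
rewrite -/(l2sq s w).
have := aM u (fun x => M^-1%:C * (w x)^*%C).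
rewrite bform_rows Re_sum l2sqZ.
under eq_bigr do rewrite -/(w _) Re_conj_mul //.
rewrite -mulr_sumr -/(l2sq s w).
have -> : l2sq s (fun x => (w x)^*%C) = l2sq s w.
  by apply: eq_bigr => x _; case: (w x) => p q; rewrite /nsq /= sqrrN.
set L := l2sq s w; set U := l2sq s u => h.
have : M * (M^-1 * L) <= M * (M / 2 * (U + M^-1 ^+ 2 * L)).
  by rewrite ler_pM2l.
have -> : M * (M^-1 * L) = L by field; rewrite gt_eqF.
have -> : M * (M / 2 * (U + M^-1 ^+ 2 * L)) = M ^+ 2 / 2 * U + L / 2.
  by field; rewrite gt_eqF.
lra.
Qed.

(** Completing squares in each row. *)
Lemma form_le_of_rows s a M : 0 < M ->
  (forall u, \sum_(x <- s) nsq (\sum_(y <- s) a x y * u y) <= M ^+ 2 * l2sq s u) ->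
  form_le s a M.
Proof.
move=> M0 h u v; rewrite bform_rows Re_sum.
set w := fun x => \sum_(y <- s) a x y * u y.
apply: (@le_trans _ _ (\sum_(x <- s) (M^-1 / 2 * nsq (w x) + M / 2 * nsq (v x)))).
  apply: ler_sum => x _; rewrite -/(w x); case: (w x) => p q; case: (v x) => c d.
  rewrite Re_mul /nsq /= -subr_ge0.
  have -> : M^-1 / 2 * (p ^+ 2 + q ^+ 2) + M / 2 * (c ^+ 2 + d ^+ 2) - (p * c - q * d)
     = M^-1 / 2 * ((p - M * c) ^+ 2 + (q + M * d) ^+ 2).
    by field; rewrite gt_eqF.
  by rewrite mulr_ge0 ?addr_ge0 ?sqr_ge0 // divr_ge0 ?invr_ge0 ?ltW.
rewrite big_split /= -!mulr_sumr mulrDr lerD2r.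
have -> : M / 2 * l2sq s u = M^-1 / 2 * (M ^+ 2 * l2sq s u).
  by field; rewrite gt_eqF.
by rewrite ler_pM2l ?h // divr_gt0 ?invr_gt0.
Qed.

End Forms.

(** * Exhaustion of a countable set *)

Section Exhaustion.
Variables (X : choiceType) (F : nat -> seq X).

Definition exhausting :=
  (forall n, uniq (F n)) /\ (forall x, \forall n \near \oo, x \in F n).

Lemma exhausting_sub (s : seq X) : exhausting ->
  \forall n \near \oo, {subset s <= F n}.
Proof.
move=> [_ hF]; elim: s => [|x s IH]; first by apply: nearW => n y.
near=> n => y; rewrite in_cons => /orP[/eqP->|ys].
  by near: n; exact: hF.
by move: y ys; near: n.
Unshelve. all: by end_near. Qed.

End Exhaustion.

Lemma exhausting_exists (X : choiceType) : countable [set: X] ->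
  exists F : nat -> seq X, exhausting F.
Proof.
move=> /countable_injP[f finj].
have /choice[F FP] : forall n, exists s : seq X,
    uniq s /\ forall x, (x \in s) = (f x < n)%N.
  move=> n; have : finite_set (f @^-1` `I_n).
    apply: finite_preimage; last exact: finite_II.
    by move=> x y _ _; apply: finj; rewrite inE.
  move=> /finite_seqP[s sE]; exists (undup s); split; first exact: undup_uniq.
  move=> x; rewrite mem_undup; have : (f @^-1` `I_n) x <-> [set` s] x by rewrite sE.
  by move=> /= [h1 h2]; apply/idP/idP.
exists F; split => [n|x]; first by have [] := FP n.
by exists (f x).+1 => // n /= h; have [_ ->] := FP n.
Qed.

(** * Square-summable families *)

Section Ell2Theory.
Variables (R : realType) (X : choiceType).
Implicit Types (v w : ell2 R X) (s : seq X) (u : X -> R[i]).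

Lemma sqsum_le u (C : R) :
  (forall s, uniq s -> \sum_(x <- s) nsq (u x) <= C) -> (sqsum u <= C%:E)%E.
Proof.
move=> h; apply: ge_ereal_sup => _ [A [finA _] <-].
move/finite_seqP : finA => [s ->].
have -> : [set` s] = [set` undup s].
  by apply/seteqP; split => x /=; rewrite mem_undup.
rewrite -fsbig_seq ?undup_uniq // sumEFin lee_fin.
under eq_bigr do rewrite normc_sq.
exact/h/undup_uniq.
Qed.

Lemma ell2_norm2_sq v : (norm2 v ^+ 2)%:E = sqsum v.
Proof.
case: v => f fP; rewrite /norm2 /=; have /asboolP := fP => fin.
have f0 := sqsum_ge0 f.
rewrite sqr_sqrtr ?fine_ge0 // fineK // ge0_fin_numE //.
Qed.

Lemma sum_le_norm2 v s : uniq s -> \sum_(x <- s) nsq (v x) <= norm2 v ^+ 2.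
Proof.
move=> us; rewrite -lee_fin ell2_norm2_sq; apply: esum_ge.
exists [set` s]; first by split => //; exact: finite_seq.
rewrite -fsbig_seq // sumEFin lee_fin.
by under [leRHS]eq_bigr do rewrite normc_sq.
Qed.

Lemma norm2_ge0 v : 0 <= norm2 v. Proof. exact: sqrtr_ge0. Qed.

Lemma norm2_sq_le v (C : R) :
  (forall s, uniq s -> \sum_(x <- s) nsq (v x) <= C) -> norm2 v ^+ 2 <= C.
Proof. by move=> h; rewrite -lee_fin ell2_norm2_sq; exact: sqsum_le. Qed.

Lemma ell2D v w x : (v + w) x = v x + w x.
Proof. by []. Qed.

Lemma ell2B v w x : (v - w) x = v x - w x.
Proof. by []. Qed.

Lemma ell2Z (c : R[i]) v x : (c *: v) x = c * v x.
Proof. by []. Qed.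

Lemma ell2_sum I (r : seq I) (f : I -> ell2 R X) x :
  (\sum_(i <- r) f i) x = \sum_(i <- r) f i x.
Proof. by apply: (big_morph (fun v : ell2 R X => v x)). Qed.

Lemma ell2_eqP v w : (forall x, v x = w x) -> v = w.
Proof. by move=> vw; apply: val_inj; apply/funext. Qed.

Lemma norm2Z (c : R) v : norm2 (c%:C *: v) ^+ 2 = c ^+ 2 * norm2 v ^+ 2.
Proof.
have le c' w : norm2 (c'%:C *: w) ^+ 2 <= c' ^+ 2 * norm2 w ^+ 2.
  apply: norm2_sq_le => s us.
  under eq_bigr do rewrite ell2Z nsqM nsq_real.
  by rewrite -mulr_sumr ler_wpM2l ?sqr_ge0 // sum_le_norm2.
apply/eqP; rewrite eq_le le /=; have [->|c0] := eqVneq c 0.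
  by rewrite expr0n mul0r sqr_ge0.
have := le c^-1 (c%:C *: v).
rewrite scalerA -rmorphM /= mulVf // rmorph1 scale1r => h.
have : c ^+ 2 * norm2 v ^+ 2 <= c ^+ 2 * (c^-1 ^+ 2 * norm2 (c%:C *: v) ^+ 2).
  by rewrite ler_wpM2l ?sqr_ge0.
move/le_trans; apply; rewrite le_eqVlt; apply/orP; left; apply/eqP.
by field; exact: c0.
Qed.

Definition fincomb s u : ell2 R X := \sum_(y <- s) u y *: delta R y.

Lemma fincombE s u x : uniq s -> fincomb s u x = if x \in s then u x else 0.
Proof.
move=> us; rewrite /fincomb ell2_sum.
under eq_bigr do rewrite ell2Z /= /delta_fun.
case: ifPn => xs.
  rewrite (bigD1_seq x) //= eqxx mulr1 big1 ?addr0 // => y yx.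
  by rewrite eq_sym (negbTE yx) mulr0.
rewrite big_seq big1 // => y ys; case: eqVneq => [xy|]; last by rewrite mulr0.
by rewrite xy ys in xs.
Qed.

Lemma norm2_fincomb s u : uniq s -> norm2 (fincomb s u) ^+ 2 <= l2sq s u.
Proof.
move=> us; apply: norm2_sq_le => t ut.
under eq_bigr do rewrite fincombE //.
rewrite (bigID (mem s)) /= [X in _ + X]big1 ?addr0; last first.
  by move=> x /negbTE ->; rewrite nsq0.
rewrite -big_filter /l2sq.
rewrite (eq_big_seq (fun x => nsq (u x))); last first.
  by move=> x; rewrite mem_filter => /andP[/= -> _].
apply: ler_sum_uniq => // [|x|x]; first exact: filter_uniq.
  by rewrite mem_filter => /andP[].
exact: nsq_ge0.
Qed.

(** Once F n contains a finite set that carries the squared norm of v up to e, the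
remaining entries of v have squared sum at most e. *)
Lemma norm2_fincomb_tail (F : nat -> seq X) v (e : R) : exhausting F -> 0 < e ->
  \forall n \near \oo, norm2 (v - fincomb (F n) v) ^+ 2 <= e.
Proof.
move=> FP e0; have [uF _] := FP.
have [s us hs] : exists2 s, uniq s & norm2 v ^+ 2 - e < \sum_(x <- s) nsq (v x).
  apply: contrapT => hn.
  have : norm2 v ^+ 2 <= norm2 v ^+ 2 - e.
    apply: norm2_sq_le => s us; rewrite leNgt; apply/negP => h.
    by apply: hn; exists s.
  lra.
near=> n; apply: norm2_sq_le => t ut.
have sF : {subset s <= F n} by near: n; exact: exhausting_sub.
under eq_bigr do rewrite ell2B fincombE //.
rewrite (bigID (mem (F n))) /= big1 ?add0r; last first.
  by move=> x ->; rewrite subrr nsq0.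
rewrite -big_filter (eq_big_seq (fun x => nsq (v x))); last first.
  by move=> x; rewrite mem_filter => /andP[/negbTE -> _]; rewrite subr0.
set t' := seq.filter _ _.
have ut' : uniq (t' ++ s).
  rewrite cat_uniq us filter_uniq //= andbT; apply/hasPn => x /sF xF.
  by rewrite mem_filter negb_and negbK xF.
have := sum_le_norm2 v ut'; rewrite big_cat /=; lra.
Unshelve. all: by end_near. Qed.

End Ell2Theory.

(** * Bounded operators and their matrices *)

Section OperatorForms.
Variables (R : realType) (X : choiceType).
Implicit Types (A B : {linear ell2 R X -> ell2 R X}) (M : R).

Lemma op_fincomb A s u x :
  A (fincomb s u) x = \sum_(y <- s) op_matrix A x y * u y.
Proof.
rewrite /fincomb linear_sum ell2_sum; apply: eq_bigr => y _.
by rewrite linearZ ell2Z mulrC.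
Qed.

Lemma op_form_le A M s : 0 < M -> (forall v, norm2 (A v) <= M * norm2 v) ->
  uniq s -> form_le s (op_matrix A) M.
Proof.
move=> M0 AM us; apply: form_le_of_rows => // u.
under eq_bigr do rewrite -op_fincomb.
apply: (le_trans (sum_le_norm2 _ us)).
apply: (@le_trans _ _ ((M * norm2 (fincomb s u)) ^+ 2)).
  by rewrite ler_pXn2r ?nnegrE ?mulr_ge0 ?norm2_ge0 ?AM // ltW.
by rewrite exprMn ler_wpM2l ?sqr_ge0 // norm2_fincomb.
Qed.

Lemma opnorm_le1P A : bounded_op A ->
  ((opnorm A <= 1)%E <-> forall v, norm2 (A v) <= norm2 v).
Proof.
move=> [M AM]; split => [h v|h]; last first.
  apply: ge_ereal_sup => _ [v /= v1 <-]; rewrite lee_fin.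
  exact: le_trans (h v) v1.
have [v0|v0] := eqVneq (norm2 v) 0.
  by have := AM v; rewrite v0 mulr0.
have vp : 0 < norm2 v by rewrite lt0r v0 norm2_ge0.
pose c := (norm2 v)^-1; pose v' := c%:C *: v.
have n1 w c' : 0 <= c' -> norm2 (c'%:C *: w) = c' * norm2 w.
  move=> c0; apply/eqP; rewrite -(@eqrXn2 _ 2) ?norm2_ge0 ?mulr_ge0 ?norm2_ge0 //.
  by rewrite norm2Z exprMn.
have c0 : 0 <= c by rewrite invr_ge0 ltW.
have : ((norm2 (A v'))%:E <= 1)%E.
  apply: le_trans h; apply: ereal_sup_ubound; exists v' => //=.
  by rewrite n1 // mulVf.
by rewrite /v' linearZ lee_fin /= n1 // mulrC ler_pdivrMr // mul1r.
Qed.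

End OperatorForms.

Section ComplexUltralimits.
Variable R : realType.
Implicit Types (u v : nat -> R[i]) (l m c : R[i]).

Definition ccvg u l :=
  (Re (u n) @[n --> free_ultra] --> Re l) /\ (Im (u n) @[n --> free_ultra] --> Im l).

Lemma ccvg_unique u l m : ccvg u l -> ccvg u m -> l = m.
Proof.
move=> [lr li] [mr mi]; apply: complex_eqP.
  exact: (cvg_unique _ lr mr).
exact: (cvg_unique _ li mi).
Qed.

Lemma ccvg_lin c u v l m : ccvg u l -> ccvg v m ->
  ccvg (fun n => c * u n + v n) (c * l + m).
Proof.
move=> [lr li] [mr mi]; split.
  under eq_fun do rewrite Re_add Re_mul.
  rewrite Re_add Re_mul; apply: cvgD => //.
  by apply: cvgB; apply: cvgM => //; exact: cvg_cst.
under eq_fun do rewrite Im_add Im_mul.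
rewrite Im_add Im_mul; apply: cvgD => //.
by apply: cvgD; apply: cvgM => //; exact: cvg_cst.
Qed.

Lemma ccvg_near_cst u l : (\forall n \near \oo, u n = l) -> ccvg u l.
Proof.
move=> ul; split; apply: cvg_near_cst; apply: near_free_ultra;
  by apply: filterS ul => n ->.
Qed.

Lemma ccvg_nsq u l : ccvg u l -> nsq (u n) @[n --> free_ultra] --> nsq l.
Proof. by move=> [lr li]; apply: cvgD; apply: cvgM. Qed.

Lemma norm_le_of_sq (a C : R) : a ^+ 2 <= C -> `|a| <= C + 1.
Proof.
move=> aC; have := sqr_ge0 (`|a| - 1).
have -> : (`|a| - 1) ^+ 2 = a ^+ 2 - 2 * `|a| + 1.
  by rewrite -[a ^+ 2]real_normK ?num_real //; ring.
have := normr_ge0 a; lra.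
Qed.

Lemma ccvg_bounded u (C : R) : (\forall n \near \oo, nsq (u n) <= C) ->
  exists l, ccvg u l.
Proof.
move=> uC; exists (ulim (Re \o u) +i* ulim (Im \o u)); split => /=.
  apply: (@cvg_ulim _ (Re \o u) (C + 1)); apply: filterS uC => n h /=.
  by apply: norm_le_of_sq; apply: le_trans h; rewrite lerDl sqr_ge0.
apply: (@cvg_ulim _ (Im \o u) (C + 1)); apply: filterS uC => n h /=.
by apply: norm_le_of_sq; apply: le_trans h; rewrite lerDr sqr_ge0.
Qed.

Lemma ccvg_dist u l : (forall e : R, 0 < e ->
  \forall n \near \oo, nsq (l - u n) <= e) -> ccvg u l.
Proof.
have sq_le (a e : R) : 0 < e -> a ^+ 2 <= e ^+ 2 -> `|a| <= e.
  move=> e0 ae; rewrite -(@ler_pXn2r _ 2) ?nnegrE ?normr_ge0 //; last exact: ltW.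
  by rewrite real_normK ?num_real.
move=> h; split; apply/cvgrPdist_le => e e0; apply: near_free_ultra;
  have := h _ (exprn_gt0 2 e0); apply: filterS => n hn;
  apply: sq_le => //; apply: le_trans hn.
  by rewrite /nsq Re_add Re_opp lerDl sqr_ge0.
by rewrite /nsq Im_add Im_opp lerDr sqr_ge0.
Qed.

End ComplexUltralimits.

Section MatrixOperators.
Variables (R : realType) (X : choiceType) (F : nat -> seq X).
Hypothesis FP : exhausting F.
Implicit Types (b : X -> X -> R[i]) (M : R) (v w : ell2 R X).

Let row b (v : X -> R[i]) x n : R[i] := \sum_(y <- F n) b x y * v y.

Lemma row_bound b M v x : 0 < M -> (forall s, uniq s -> form_le s b M) ->
  \forall n \near \oo, nsq (row b v x n) <= M ^+ 2 * norm2 v ^+ 2.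
Proof.
move=> M0 bM; have [uF hF] := FP; apply: filterS (hF x) => n xF.
have h := form_le_rows v M0 (bM _ (uF n)).
apply: (@le_trans _ _ (\sum_(z <- F n) nsq (row b v z n))).
  by rewrite (big_rem x) //= lerDl; apply: sumr_ge0 => z _; exact: nsq_ge0.
apply: (le_trans h); rewrite ler_wpM2l ?sqr_ge0 //.
exact: sum_le_norm2.
Qed.

Lemma limit_rows_le b M v (f : X -> R[i]) s : 0 < M ->
  (forall s, uniq s -> form_le s b M) ->
  (forall x, ccvg (row b v x) (f x)) -> uniq s ->
  \sum_(x <- s) nsq (f x) <= M ^+ 2 * norm2 v ^+ 2.
Proof.
move=> M0 bM fP us; have [uF hF] := FP.
have cv : \sum_(x <- s) nsq (row b v x n) @[n --> free_ultra] -->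
          \sum_(x <- s) nsq (f x).
  apply: (@cvg_bsum _ _ _ s (fun x n => nsq (row b v x n))) => x _.
  exact: ccvg_nsq.
apply: (cvgr_to_le cv); apply: near_free_ultra.
apply: filterS (exhausting_sub s FP) => n sF.
apply: (@le_trans _ _ (\sum_(x <- F n) nsq (row b v x n))).
  by apply: ler_sum_uniq => // x; exact: nsq_ge0.
apply: (le_trans (form_le_rows v M0 (bM _ (uF n)))).
by rewrite ler_wpM2l ?sqr_ge0 // sum_le_norm2.
Qed.

Lemma norm2_le_of_sq v w M : 0 < M ->
  norm2 w ^+ 2 <= M ^+ 2 * norm2 v ^+ 2 -> norm2 w <= M * norm2 v.
Proof.
move=> M0; have M1 := ltW M0.
by rewrite -exprMn ler_pXn2r ?nnegrE ?mulr_ge0 ?norm2_ge0.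
Qed.

(** The partial sums over F n of each row of b v are bounded, and their ultralimit
depends linearly on v; this replaces the summation of a complex series. *)
Theorem matrix_operator b M : 0 < M -> (forall s, uniq s -> form_le s b M) ->
  exists B : {linear ell2 R X -> ell2 R X},
    (forall v, norm2 (B v) <= M * norm2 v) /\ forall x y, op_matrix B x y = b x y.
Proof.
move=> M0 bM; have [uF hF] := FP.
have /choice[f fP] : forall v, exists f : X -> R[i], forall x, ccvg (row b v x) (f x).
  move=> v; have /choice[f fP] : forall x, exists l, ccvg (row b v x) l.
    by move=> x; exact: (ccvg_bounded (row_bound v x M0 bM)).
  by exists f.
have fl2 v : f v \in @ell2_pred R X.
  apply/asboolP; apply: le_lt_trans (ltry (M ^+ 2 * norm2 v ^+ 2)).
  by apply: sqsum_le => s; exact: (limit_rows_le M0 bM (fP v)).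
pose Bf v : ell2 R X := Ell2 (fl2 v).
have Bl : linear Bf.
  move=> c v w; apply: ell2_eqP => x; rewrite ell2D ell2Z /=.
  apply: ccvg_unique (fP _ x) _.
  have -> : row b (c *: v + w : ell2 R X) x = fun n => c * row b v x n + row b w x n.
    apply/funext => n; rewrite /row mulr_sumr -big_split /=.
    apply: eq_bigr => y _.
    change (b x y * (c * v y + w y) = c * (b x y * v y) + b x y * w y).
    by rewrite mulrDr mulrCA.
  exact: ccvg_lin.
pose B : {linear ell2 R X -> ell2 R X} :=
  HB.pack_for {linear ell2 R X -> ell2 R X} Bf
    (GRing.isLinear.Build _ _ _ _ Bf Bl).
exists B; split => [v|x y].
  apply: norm2_le_of_sq => //; apply: norm2_sq_le => s us.
  exact: (limit_rows_le M0 bM (fP v)).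
apply: ccvg_unique (fP (delta R y) x) _; apply: ccvg_near_cst.
apply: filterS (hF y) => n yF.
rewrite /row (bigD1_seq y) //= /delta_fun eqxx mulr1 big1 ?addr0 // => z zy.
by rewrite (negbTE zy) mulr0.
Qed.

(** Continuity of B identifies B v with the limit of its values at the truncations
of v, which only involve the matrix of B. *)
Theorem operator_le_of_matrix (B : {linear ell2 R X -> ell2 R X}) M : 0 < M ->
  bounded_op B -> (forall s, uniq s -> form_le s (op_matrix B) M) ->
  forall v, norm2 (B v) <= M * norm2 v.
Proof.
move=> M0 [K BK] bM v; have [uF hF] := FP.
apply: norm2_le_of_sq => //; apply: norm2_sq_le => s us.
apply: (limit_rows_le M0 bM _ us) => x; apply: ccvg_dist => e e0.
have d0 : 0 < e / (K ^+ 2 + 1) by rewrite divr_gt0 // ltr_pwDr // sqr_ge0.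
apply: filterS (norm2_fincomb_tail v FP d0) => n hn.
rewrite /row -op_fincomb -ell2B -linearB.
set t := v - _ in hn *.
have h1 : nsq (B t x) <= norm2 (B t) ^+ 2.
  have := @sum_le_norm2 _ _ (B t) [:: x] erefl.
  by rewrite big_cons big_nil addr0.
have h2 : norm2 (B t) ^+ 2 <= K ^+ 2 * norm2 t ^+ 2.
  rewrite -exprMn; have := BK t; have := norm2_ge0 (B t) => h3 h4.
  by rewrite ler_pXn2r ?nnegrE //; exact: le_trans h3 h4.
apply: (le_trans h1); apply: (le_trans h2).
apply: (@le_trans _ _ ((K ^+ 2 + 1) * (e / (K ^+ 2 + 1)))).
  apply: ler_pM; rewrite ?sqr_ge0 // lerDl //.
by rewrite mulrC divfK // gt_eqF // ltr_pwDr // sqr_ge0.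
Qed.

End MatrixOperators.

(** * Real positive and conditionally negative definite kernels *)

Section RealKernels.
Variables (R : realType) (X : Type).
Implicit Types (k p B : X -> X -> R) (r : seq (R * X)).

(** Families of points with weights are lists of pairs, in which a point may be
repeated: enlarging a family by one point is then a list constructor. *)
Definition qform r k : R :=
  \sum_(a <- r) \sum_(b <- r) a.1 * b.1 * k a.2 b.2.

Definition real_pd k := (forall x y, k x y = k y x) /\ forall r, 0 <= qform r k.

Definition real_cnd k := (forall x y, k x y = k y x) /\
  forall r, \sum_(a <- r) a.1 = 0 -> qform r k <= 0.

Lemma qformD r k k' : qform r (fun x y => k x y + k' x y) = qform r k + qform r k'.
Proof.
rewrite /qform -big_split; apply: eq_bigr => a _ /=.
by rewrite -big_split; apply: eq_bigr => b _ /=; rewrite mulrDr.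
Qed.

Lemma qformZ r (c : R) k : qform r (fun x y => c * k x y) = c * qform r k.
Proof.
rewrite /qform mulr_sumr; apply: eq_bigr => a _ /=.
by rewrite mulr_sumr; apply: eq_bigr => b _ /=; rewrite mulrCA.
Qed.

Lemma qform_prod r (f g : X -> R) : qform r (fun x y => f x * g y) =
  (\sum_(a <- r) a.1 * f a.2) * (\sum_(a <- r) a.1 * g a.2).
Proof.
rewrite /qform mulr_suml; apply: eq_bigr => a _.
by rewrite mulr_sumr; apply: eq_bigr => b _; rewrite mulrACA.
Qed.

Lemma real_pdD k k' : real_pd k -> real_pd k' -> real_pd (fun x y => k x y + k' x y).
Proof.
move=> [sk pk] [sk' pk']; split=> [x y|r]; first by rewrite sk sk'.
by rewrite qformD addr_ge0.
Qed.

Lemma real_pdZ (c : R) k : 0 <= c -> real_pd k -> real_pd (fun x y => c * k x y).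
Proof.
move=> c0 [sk pk]; split=> [x y|r]; first by rewrite sk.
by rewrite qformZ mulr_ge0.
Qed.

Lemma real_cndD k k' : real_cnd k -> real_cnd k' ->
  real_cnd (fun x y => k x y + k' x y).
Proof.
move=> [sk pk] [sk' pk']; split=> [x y|r r0]; first by rewrite sk sk'.
by rewrite qformD -oppr_ge0 opprD addr_ge0 // oppr_ge0 ?pk ?pk'.
Qed.

Lemma real_cndZ (c : R) k : 0 <= c -> real_cnd k -> real_cnd (fun x y => c * k x y).
Proof.
move=> c0 [sk pk]; split=> [x y|r r0]; first by rewrite sk.
by rewrite qformZ mulr_ge0_le0 ?pk.
Qed.

Lemma real_pd_rank1 (f : X -> R) : real_pd (fun x y => f x * f y).
Proof.
split=> [x y|r]; first exact: mulrC.
by rewrite qform_prod -expr2 sqr_ge0.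
Qed.

Lemma real_cnd_sqdist (f : X -> R) : real_cnd (fun x y => (f x - f y) ^+ 2).
Proof.
split=> [x y|r r0]; first by rewrite -sqrrN opprB.
have -> : (fun x y => (f x - f y) ^+ 2) =
    (fun x y => (f x ^+ 2 * 1 + 1 * f y ^+ 2) + (- 2) * (f x * f y)).
  by apply/funext => x; apply/funext => y; ring.
rewrite 2!qformD 2!qform_prod qformZ qform_prod.
have -> : \sum_(a <- r) a.1 * 1 = 0 :> R by under eq_bigr do rewrite mulr1.
rewrite mulr0 mul0r !add0r mulNr oppr_le0 -expr2.
by rewrite mulr_ge0 ?sqr_ge0.
Qed.

Lemma real_pd_diag k x : real_pd k -> 0 <= k x x.
Proof.
by move=> [_ /(_ [:: (1, x)])]; rewrite /qform !big_cons !big_nil /= !addr0 !mul1r.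
Qed.

Lemma real_pd_bound k x y : real_pd k -> 2 * `|k x y| <= k x x + k y y.
Proof.
move=> [sk pk]; have h c : 0 <= k x x + 2 * c * k x y + c ^+ 2 * k y y.
  have := pk [:: (1, x); (c, y)]; rewrite /qform !big_cons !big_nil /= !addr0.
  by rewrite (sk y x) => h; apply: le_trans h _; rewrite le_eqVlt; apply/orP;
    left; apply/eqP; ring.
have := h 1; have := h (- 1); rewrite sqrrN expr1n.
case: (ler0P (k x y)); lra.
Qed.

Lemma real_cnd_ge0 k x y : real_cnd k -> (forall x, k x x = 0) -> 0 <= k x y.
Proof.
move=> [sk ck] k0; have := ck [:: (1, x); (-1, y)].
rewrite /qform !big_cons !big_nil /= !addr0 subrr => /(_ erefl).
rewrite !k0 (sk y x); lra.
Qed.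

End RealKernels.

(** * Comparison with complex kernels *)

Section Complexify.
Variables (R : realType) (X : choiceType).
Implicit Types (k : X -> X -> R).

(** The real and the imaginary parts of the coefficients contribute separately; the
cross terms cancel by symmetry of k. *)
Lemma complex_qform k n (x : 'I_n -> X) (c : 'I_n -> R[i]) :
  (forall x y, k x y = k y x) ->
  \sum_(i < n) \sum_(j < n) c i * (c j)^*%C * (k (x i) (x j))%:C =
  (qform [seq (Re (c i), x i) | i <- index_enum 'I_n] k +
   qform [seq (Im (c i), x i) | i <- index_enum 'I_n] k)%:C.
Proof.
move=> sk; apply: complex_eqP => /=.
  rewrite /qform Re_sum !big_map -big_split; apply: eq_bigr => i _ /=.
  rewrite Re_sum !big_map -big_split; apply: eq_bigr => j _ /=.
  by case: (c i) => a b; case: (c j) => a' b'; rewrite !Re_mul /=; ring.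
rewrite Im_sum; under eq_bigr do rewrite Im_sum.
pose f i j := Im (c i) * Re (c j) * k (x i) (x j).
transitivity (\sum_(i < n) \sum_(j < n) f i j - \sum_(i < n) \sum_(j < n) f j i).
  rewrite -sumrB; apply: eq_bigr => i _; rewrite -sumrB; apply: eq_bigr => j _.
  rewrite /f (sk (x j)).
  by case: (c i) => a b; case: (c j) => a' b'; rewrite !Im_mul !Re_mul /=; ring.
by rewrite exchange_big subrr.
Qed.

Lemma real_pd_complex k : real_pd k -> positive_definite (fun x y => (k x y)%:C).
Proof.
move=> [sk pk] n x c; rewrite complex_qform // lecR.
by rewrite addr_ge0.
Qed.

Lemma real_cnd_complex k : real_cnd k ->
  conditionally_negative_definite (fun x y => (k x y)%:C).
Proof.
move=> [sk pk]; split=> [x y|n x c c0]; first by rewrite sk conjc_real.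
rewrite complex_qform // lecR -oppr_ge0 opprD.
by apply: addr_ge0; rewrite oppr_ge0; apply: pk; rewrite big_map /=;
  [rewrite -Re_sum c0 | rewrite -Im_sum c0].
Qed.

Lemma qform_Re (k : X -> X -> R[i]) (r : seq (R * X)) :
  exists n (x : 'I_n -> X) (c : 'I_n -> R[i]),
  Re (\sum_(i < n) \sum_(j < n) c i * (c j)^*%C * k (x i) (x j)) =
    qform r (fun x y => Re (k x y)) /\
  \sum_(i < n) c i = (\sum_(a <- r) a.1)%:C.
Proof.
exists (size r), (fun i => (tnth (in_tuple r) i).2),
  (fun i => (tnth (in_tuple r) i).1%:C); split.
  rewrite Re_sum /qform [RHS]big_tnth; apply: eq_bigr => i _.
  rewrite Re_sum [RHS]big_tnth; apply: eq_bigr => j _.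
  rewrite Re_mul -conjc_real -!rmorphM /=; ring.
by rewrite [in RHS]big_tnth rmorph_sum.
Qed.

Lemma Re_positive_definite (k : X -> X -> R[i]) (r : seq (R * X)) :
  positive_definite k -> 0 <= qform r (fun x y => Re (k x y)).
Proof.
move=> pk; have [n [x [c [<- _]]]] := qform_Re k r.
by have := pk n x c; rewrite lecE => /andP[].
Qed.

Lemma Re_cnd (k : X -> X -> R[i]) : conditionally_negative_definite k ->
  real_cnd (fun x y => Re (k x y)).
Proof.
move=> [hk ck]; split => [x y|r r0]; first by rewrite (hk y x); case: (k y x).
have [n [x [c [<- sc]]]] := qform_Re k r.
by have := ck n x c; rewrite sc r0 => /(_ erefl); rewrite lecE => /andP[].
Qed.

End Complexify.

(** * Splitting on a finite set *)

Section FiniteSplitting.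
Variables (R : realType) (X : eqType).
Implicit Types (s : seq X) (k p B W : X -> X -> R).

(** When p is the squared distance of a map R and B the Gram kernel of a map S into
Hilbert spaces, this is |R(x) - R(y)|^2 + |S(x) + S(y)|^2. *)
Definition splitting p B x y : R := p x y + B x x + B y y + 2 * B x y.

Definition dsum s (f : X -> X -> R) : R := \sum_(x <- s) \sum_(y <- s) f x y.

Lemma dsum_transpose s f : dsum s (fun x y => f y x) = dsum s f.
Proof. by rewrite /dsum exchange_big. Qed.

Lemma dsumD s f g : dsum s (fun x y => f x y + g x y) = dsum s f + dsum s g.
Proof.
by rewrite /dsum -big_split; apply: eq_bigr => x _; rewrite -big_split.
Qed.

Lemma dsumZ s (c : R) f : dsum s (fun x y => c * f x y) = c * dsum s f.
Proof.
by rewrite /dsum mulr_sumr; apply: eq_bigr => x _; rewrite mulr_sumr.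
Qed.

Lemma eq_dsum s f g : (forall x y, x \in s -> y \in s -> f x y = g x y) ->
  dsum s f = dsum s g.
Proof.
by move=> fg; apply: eq_big_seq => x xs; apply: eq_big_seq => y ys; exact: fg.
Qed.

Definition rowsum s W x : R := \sum_(y <- s) W x y.

(** The functionals W that are nonnegative on all kernels (u_x - u_y)^2 and
(u_x + u_y)^2, which generate the splittings. *)
Definition balanced s W := (forall x y, W x y = W y x) /\
  forall u : X -> R,
    `|dsum s (fun x y => W x y * u x * u y)| <= \sum_(x <- s) rowsum s W x * u x ^+ 2.

(** Used with e = 1 and e = - 1. *)
Lemma dsum_split_sq s W (u : X -> R) (e : R) : (forall x y, W x y = W y x) ->
  e ^+ 2 = 1 ->
  dsum s (fun x y => W x y * (u x + e * u y) ^+ 2) =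
  2 * (\sum_(x <- s) rowsum s W x * u x ^+ 2
       + e * dsum s (fun x y => W x y * u x * u y)).
Proof.
move=> sW e1.
have -> : (fun x y => W x y * (u x + e * u y) ^+ 2) =
  (fun x y => (W x y * u x ^+ 2 + W y x * u y ^+ 2) + 2 * e * (W x y * u x * u y)).
  apply/funext => x; apply/funext => y.
  rewrite sqrrD exprMn e1 (sW y x); ring.
rewrite dsumD dsumZ dsumD (dsum_transpose s (fun x y => W x y * u x ^+ 2)).
have -> : dsum s (fun x y => W x y * u x ^+ 2) =
    \sum_(x <- s) rowsum s W x * u x ^+ 2.
  by apply: eq_bigr => x _; rewrite mulr_suml.
ring.
Qed.

(** The splittings form a convex cone.  A functional W that separates k from it can
be symmetrized, since all kernels involved are symmetric, and is balanced because
it is nonnegative on the rank-one generators. *)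
Lemma finite_splitting s k (e : R) : 0 < e -> (forall x y, k x y = k y x) ->
  (forall W, balanced s W -> 0 <= dsum s (fun x y => W x y * k x y)) ->
  exists p B, [/\ real_cnd p, forall x, p x x = 0, real_pd B &
    forall x y, x \in s -> y \in s -> `|splitting p B x y - k x y| <= e].
Proof.
move=> e0 sk kW.
pose Q : set (X * X -> R) := [set q | exists p B, [/\ real_cnd p,
  forall x, p x x = 0, real_pd B & q = fun z => splitting p B z.1 z.2]].
have cnd0 : real_cnd (fun _ _ : X => 0 : R).
  split=> // r _; rewrite /qform big1 // => a _.
  by rewrite big1 // => b _; rewrite mulr0.
have pd0 : real_pd (fun _ _ : X => 0 : R).
  split=> // r; rewrite /qform big1 // => a _.
  by rewrite big1 // => b _; rewrite mulr0.
have allE (g : X * X -> R) :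
    \sum_(z <- [seq (x, y) | x <- s, y <- s]) g z = dsum s (fun x y => g (x, y)).
  by rewrite big_allpairs.
have [||||] := @cone_separation R (X * X)%type
    [seq (x, y) | x <- s, y <- s] Q (fun z => k z.1 z.2).
- exists (fun _ _ => 0), (fun _ _ => 0); split => //.
  by apply/funext => z; rewrite /splitting; ring.
- move=> _ _ [p [B [cp p0 pB ->]]] [p' [B' [cp' p0' pB' ->]]].
  exists (fun x y => p x y + p' x y), (fun x y => B x y + B' x y); split.
  + exact: real_cndD.
  + by move=> x; rewrite p0 p0' addr0.
  + exact: real_pdD.
  + by apply/funext => z; rewrite /splitting; ring.
- move=> c _ c0 [p [B [cp p0 pB ->]]].
  exists (fun x y => c * p x y), (fun x y => c * B x y); split.
  + exact: real_cndZ.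
  + by move=> x; rewrite p0 mulr0.
  + exact: real_pdZ.
  + by apply/funext => z; rewrite /splitting; ring.
- move=> /(_ _ (exprn_gt0 2 e0))[_ [p [B [cp p0 pB ->]]]] h.
  exists p, B; split => // x y xs ys.
  rewrite -(@ler_pXn2r _ 2) ?nnegrE ?normr_ge0 //; last exact: ltW.
  rewrite real_normK ?num_real //; apply: le_trans h.
  rewrite allE /= /dsum (big_rem x) //= (big_rem y ys) /= -addrA lerDl.
  by rewrite addr_ge0 ?sumr_ge0 // => i _; rewrite ?sumr_ge0 // => *; exact: sqr_ge0.
move=> [w wQ]; rewrite allE /= => wk.
pose W x y := (w (x, y) + w (y, x)) / 2.
have sW x y : W x y = W y x by rewrite /W addrC.
have wW (q : X -> X -> R) : (forall x y, q x y = q y x) ->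
    dsum s (fun x y => q x y * w (x, y)) = dsum s (fun x y => W x y * q x y).
  move=> sq; have -> : (fun x y => W x y * q x y) =
      (fun x y => 2^-1 * (q x y * w (x, y) + q y x * w (y, x))).
    by apply/funext => x; apply/funext => y; rewrite /W (sq y x); field.
  rewrite dsumZ dsumD (dsum_transpose s (fun x y => q x y * w (x, y))).
  by field.
suff bW : balanced s W.
  by have := kW W bW; rewrite -wW // leNgt wk.
split => // u.
have P : 0 <= dsum s (fun x y => W x y * (u x + 1 * u y) ^+ 2).
  rewrite -(wW (fun x y => (u x + 1 * u y) ^+ 2)); last first.
    by move=> x y; rewrite !mul1r addrC.
  have /wQ : Q (fun z => (u z.1 + 1 * u z.2) ^+ 2).
    exists (fun _ _ => 0), (fun x y => u x * u y); split => //.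
      exact: real_pd_rank1.
    by apply/funext => z; rewrite /splitting; ring.
  by rewrite allE.
have N : 0 <= dsum s (fun x y => W x y * (u x + -1 * u y) ^+ 2).
  rewrite -(wW (fun x y => (u x + -1 * u y) ^+ 2)); last first.
    by move=> x y; ring.
  have /wQ : Q (fun z => (u z.1 + -1 * u z.2) ^+ 2).
    exists (fun x y => (u x - u y) ^+ 2), (fun _ _ => 0); split => //.
    - exact: real_cnd_sqdist.
    - by move=> x; rewrite subrr expr0n.
    - by apply/funext => z; rewrite /splitting; ring.
  by rewrite allE.
rewrite dsum_split_sq ?expr1n // in P.
rewrite dsum_split_sq ?sqrrN ?expr1n // in N.
by rewrite ler_norml; apply/andP; split; lra.
Qed.

End FiniteSplitting.

(** * Pairing a contractive Schur multiplier with a balanced functional *)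

Section Pairing.
Variables (R : realType) (X : choiceType) (F : nat -> seq X).
Hypothesis FP : exhausting F.

Definition schur_contractive (k : X -> X -> R[i]) :=
  forall A : {linear ell2 R X -> ell2 R X}, (forall v, norm2 (A v) <= norm2 v) ->
  exists B : {linear ell2 R X -> ell2 R X}, (forall v, norm2 (B v) <= norm2 v) /\
    forall x y, op_matrix B x y = k x y * op_matrix A x y.

(** Polarization, and separation of the real and imaginary parts of the
vectors. *)
Lemma real_form_le (t : seq X) (b : X -> X -> R) : (forall x y, b x y = b y x) ->
  (forall u : X -> R, `|dsum t (fun x y => b x y * u x * u y)| <= \sum_(x <- t) u x ^+ 2) ->
  form_le t (fun x y => (b x y)%:C) 1.
Proof.
move=> sb hb.
have bil (f g : X -> R) : dsum t (fun x y => b x y * f y * g x) <=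
    (\sum_(x <- t) f x ^+ 2 + \sum_(x <- t) g x ^+ 2) / 2.
  have P := le_trans (ler_norm _) (hb (fun x => f x + g x)).
  have := hb (fun x => f x - g x); rewrite ler_norml => /andP[N _].
  have e1 : dsum t (fun x y => b x y * (f x + g x) * (f y + g y)) =
     dsum t (fun x y => b x y * (f x - g x) * (f y - g y)) +
     4 * dsum t (fun x y => b x y * f y * g x).
    rewrite (_ : 4 * _ = 2 * dsum t (fun x y => b x y * f y * g x)
       + 2 * dsum t (fun x y => b y x * f x * g y)); last first.
      by rewrite (dsum_transpose t (fun x y => b x y * f y * g x)); ring.
    rewrite -!dsumZ -!dsumD; apply: eq_dsum => x y _ _.
    by rewrite (sb y x); ring.
  have e2 : \sum_(x <- t) (f x + g x) ^+ 2 + \sum_(x <- t) (f x - g x) ^+ 2 =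
     2 * (\sum_(x <- t) f x ^+ 2 + \sum_(x <- t) g x ^+ 2).
    rewrite -!big_split mulr_sumr; apply: eq_bigr => x _ /=; ring.
  lra.
move=> u v; rewrite /bform Re_sum.
have -> : \sum_(x <- t) Re (\sum_(y <- t) (b x y)%:C * u y * v x) =
   dsum t (fun x y => b x y * Re (u y) * Re (v x)) +
   dsum t (fun x y => b x y * Im (u y) * - Im (v x)).
  rewrite -dsumD; apply: eq_bigr => x _; rewrite Re_sum; apply: eq_bigr => y _.
  by rewrite !Re_mul Im_mul /=; ring.
have := bil (fun x => Re (u x)) (fun x => Re (v x)).
have := bil (fun x => Im (u x)) (fun x => - Im (v x)).
rewrite /l2sq /nsq !big_split /=.
under [X in _ <= (_ + X) / 2]eq_bigr do rewrite sqrrN.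
lra.
Qed.

(** The matrix W_xy / sqrt(D_x D_y), extended by zero, is a contraction by
hypothesis.  Its image under the multiplier is a contraction again, and evaluating
that at the vector sqrt(D) gives the sum of W k on the left and the squared norm
of sqrt(D) on the right. *)
Lemma schur_pairing (k : X -> X -> R) s (W : X -> X -> R) (D : X -> R) :
  schur_contractive (fun x y => (k x y)%:C) -> uniq s ->
  (forall x y, W x y = W y x) -> (forall x, x \in s -> 0 < D x) ->
  (forall u : X -> R, `|dsum s (fun x y => W x y * u x * u y)|
      <= \sum_(x <- s) D x * u x ^+ 2) ->
  dsum s (fun x y => W x y * k x y) <= \sum_(x <- s) D x.
Proof.
move=> kC us sW D0 WD.
pose d x := if x \in s then (Num.sqrt (D x))^-1 else 0.
pose b x y := d x * W x y * d y.
have sqD x : x \in s -> Num.sqrt (D x) ^+ 2 = D x.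
  by move=> /D0/ltW D1; rewrite sqr_sqrtr.
have sD0 x : x \in s -> Num.sqrt (D x) != 0.
  by move=> /D0; rewrite -sqrtr_gt0 => /gt_eqF ->.
have d0 x : x \notin s -> d x = 0 by rewrite /d => /negbTE ->.
have bC t : uniq t -> form_le t (fun x y => (b x y)%:C) 1.
  move=> ut; apply: real_form_le => [x y|u]; first by rewrite /b sW; ring.
  pose u' x := if x \in t then d x * u x else 0.
  have -> : dsum t (fun x y => b x y * u x * u y) =
            dsum s (fun x y => W x y * u' x * u' y).
    rewrite /dsum (big_uniq_support us ut); last first.
      move=> x /d0 dx; rewrite big1 // => y _; rewrite /b dx; ring.
    rewrite big_mkcond; apply: eq_bigr => x _; rewrite /u'.
    case: ifP => xt; last by rewrite big1 // => y _; ring.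
    rewrite (big_uniq_support us ut); last by move=> y /d0 dy; rewrite /b dy; ring.
    rewrite big_mkcond; apply: eq_bigr => y _; rewrite /b.
    by case: ifP => yt; ring.
  apply: (le_trans (WD u')).
  rewrite (eq_big_seq (fun x => if x \in t then u x ^+ 2 else 0)); last first.
    move=> x xs; rewrite /u'; case: ifP => _; last by ring.
    rewrite /d xs exprMn mulrA -{1}sqD // -exprMn mulfV ?sD0 //; ring.
  rewrite -big_mkcond -big_filter; apply: ler_sum_uniq => //.
  - exact: filter_uniq.
  - by move=> x; rewrite mem_filter => /andP[].
  - by move=> x; exact: sqr_ge0.
have [A [An Ab]] := matrix_operator FP ltr01 bC.
have Ac v : norm2 (A v) <= norm2 v by have := An v; rewrite mul1r.
have [B [Bn Bb]] := kC A Ac.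
have Bn1 v : norm2 (B v) <= 1 * norm2 v by rewrite mul1r.
have := op_form_le ltr01 Bn1 us (fun x => (Num.sqrt (D x))%:C)
  (fun x => (Num.sqrt (D x))%:C).
have -> : l2sq s (fun x => (Num.sqrt (D x))%:C) = \sum_(x <- s) D x.
  by apply: eq_big_seq => x xs; rewrite nsq_real sqD.
have -> : Re (bform s (op_matrix B) (fun x => (Num.sqrt (D x))%:C)
     (fun x => (Num.sqrt (D x))%:C)) = dsum s (fun x y => W x y * k x y).
  rewrite /bform Re_sum; apply: eq_big_seq => x xs.
  rewrite Re_sum; apply: eq_big_seq => y ys.
  rewrite Bb Ab -!rmorphM /= /b /d xs ys; field; by rewrite !sD0.
lra.
Qed.

End Pairing.

Lemma expR_taylor1 (R : realType) (z : R) : `|z| <= 2^-1 ->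
  0 <= expR z - 1 - z <= 2 * z ^+ 2.
Proof.
rewrite ler_norml => /andP[z1 z2]; apply/andP; split.
  by have := expR_ge1Dx z; lra.
have := expR_ge1Dx (- z); rewrite expRN => h.
have e0 := expR_gt0 z.
have h1 : expR z * (1 - z) <= 1.
  have := ler_wpM2l (ltW e0) h; rewrite mulfV ?gt_eqF //.
suff : (expR z - 1 - z - 2 * z ^+ 2) * (1 - z) <= 0.
  by rewrite pmulr_lle0; lra.
have -> : (expR z - 1 - z - 2 * z ^+ 2) * (1 - z) =
   expR z * (1 - z) - 1 - z ^+ 2 * (1 - 2 * z) by ring.
have : 0 <= z ^+ 2 * (1 - 2 * z) by rewrite mulr_ge0 ?sqr_ge0 //; lra.
lra.
Qed.

Lemma dsum_ge_term (R : realType) (X : eqType) (s : seq X) (f : X -> X -> R) x y :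
  (forall x y, 0 <= f x y) -> x \in s -> y \in s -> f x y <= dsum s f.
Proof.
move=> f0 xs ys; rewrite /dsum (big_rem x) //= (big_rem y ys) /= -addrA lerDl.
by rewrite addr_ge0 ?sumr_ge0 // => i _; rewrite ?sumr_ge0.
Qed.

Lemma ler_dsum (R : realType) (X : eqType) (s : seq X) (f g : X -> X -> R) :
  (forall x y, x \in s -> y \in s -> f x y <= g x y) -> dsum s f <= dsum s g.
Proof.
move=> fg; rewrite /dsum big_seq [leRHS]big_seq; apply: ler_sum => x xs.
by rewrite big_seq [leRHS]big_seq; apply: ler_sum => y ys; exact: fg.
Qed.

(** * From a contractive semigroup to a splitting *)

Section Derivative.
Variables (R : realType) (X : choiceType) (F : nat -> seq X).
Hypothesis FP : exhausting F.

(** Pairing with e^{-tk} gives <W, e^{-tk}> <= <W, 1>, with equality at t = 0, so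
that the derivative - <W, k> at 0 is nonpositive. *)
Lemma balanced_pairing_ge0 (k : X -> X -> R) s W :
  (forall t, 0 < t -> schur_contractive (fun x y => (expR (- t * k x y))%:C)) ->
  uniq s -> balanced s W -> 0 <= dsum s (fun x y => W x y * k x y).
Proof.
move=> kC us [sW bW].
have r0 x : x \in s -> 0 <= rowsum s W x.
  move=> xs; have := le_trans (normr_ge0 _) (bW (fun y => (y == x)%:R)).
  rewrite (bigD1_seq x) //= eqxx expr1n mulr1 big1 ?addr0 // => y /negbTE ->.
  by rewrite expr0n mulr0.
have main t : 0 < t ->
    dsum s (fun x y => W x y * expR (- t * k x y)) <= dsum s W.
  move=> t0; apply/ler_addgt0Pr => e e0.
  (* the row sums may vanish; adding e / n makes the weights positive *)
  pose n : R := (size s).+1%:R.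
  have n0 : 0 < n by rewrite ltr0n.
  pose D x := rowsum s W x + e / n.
  have en : 0 < e / n by rewrite divr_gt0.
  have := @schur_pairing _ _ _ FP (fun x y => expR (- t * k x y)) s W D
    (kC t t0) us sW.
  move=> /(_ (fun x xs => ltr_wpDl (r0 x xs) en)) h.
  apply: (@le_trans _ _ (\sum_(x <- s) D x)).
    apply: h => u; apply: (le_trans (bW u)); apply: ler_sum => x _.
    by rewrite ler_wpM2r ?sqr_ge0 // lerDl ltW.
  rewrite /D big_split /= lerD2l big_const_seq count_predT iter_addr_0.
  rewrite -mulr_natr -mulrA ger_pMr // mulrC ler_pdivrMr // mul1r ler_nat.
  exact: leqnSn.
pose K := dsum s (fun x y => `|k x y|).
have K0 : 0 <= K by apply: sumr_ge0 => x _; apply: sumr_ge0.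
(* for t <= t0 the exponents t * k are at most 1/2 in absolute value on s *)
pose t0 := (2 * (K + 1))^-1.
have t0p : 0 < t0 by rewrite invr_gt0; lra.
suff : 0 <= t0 * dsum s (fun x y => W x y * k x y) by rewrite pmulr_rge0.
apply: (@linear_ge0_of_quadratic _ _
  (dsum s (fun x y => 2 * `|W x y| * (t0 * k x y) ^+ 2))) => c /andP[c0 c1].
rewrite -dsumZ -dsumZ -dsumZ -dsumD.
have := main (c * t0) (mulr_gt0 c0 t0p); rewrite -subr_ge0.
have -> : dsum s W - dsum s (fun x y => W x y * expR (- (c * t0) * k x y)) =
  dsum s (fun x y => W x y * (1 - expR (- (c * t0) * k x y))).
  rewrite -[- dsum s _]mulN1r -dsumZ -dsumD; apply: eq_dsum => x y _ _; ring.
move=> h; apply: (le_trans h); apply: ler_dsum => x y xs ys.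
set z := - (c * t0) * k x y.
have zle : `|z| <= 2^-1.
  have ct0 : 0 <= c * t0 := ltW (mulr_gt0 c0 t0p).
  rewrite /z normrM normrN (ger0_norm ct0).
  have kK : `|k x y| <= K.
    exact: (@dsum_ge_term _ _ s (fun x y => `|k x y|)).
  apply: (@le_trans _ _ (1 * t0 * K)).
    by apply: ler_pM => //; rewrite ler_pM2r.
  rewrite mul1r /t0 mulrC ler_pdivrMr; lra.
have /andP[h1 h2] := expR_taylor1 zle.
have -> : c * (t0 * (W x y * k x y)) = - (W x y * z) by rewrite /z; ring.
have -> : c ^+ 2 * (2 * `|W x y| * (t0 * k x y) ^+ 2) = `|W x y| * (2 * z ^+ 2).
  by rewrite /z; ring.
rewrite -lerBlDl opprK.
have -> : W x y * (1 - expR z) + W x y * z = W x y * - (expR z - 1 - z) by ring.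
apply: (le_trans (ler_norm _)); rewrite normrM normrN.
by rewrite ler_wpM2l // ger0_norm.
Qed.

(** Both parts stay bounded at each pair of points: p vanishes on the diagonal, so
4 B_xx is close to k x x; positivity of B then bounds B_xy, and p is squeezed
between 0 and k up to the error. *)
Lemma splitting_limit (k : X -> X -> R) :
  (forall n, exists p B, [/\ real_cnd p, forall x, p x x = 0, real_pd B &
     forall x y, x \in F n -> y \in F n -> `|splitting p B x y - k x y| <= n.+1%:R^-1]) ->
  exists p B, [/\ real_cnd p, forall x, p x x = 0, real_pd B &
     forall x y, splitting p B x y = k x y].
Proof.
move=> /choice[p /choice[B H]]; have [uF hF] := FP.
have hF2 x y : \forall n \near \oo, x \in F n /\ y \in F n.
  by apply: filterS2 (hF x) (hF y).
have n1 n : (n.+1%:R : R)^-1 <= 1 by rewrite invf_le1 ?ltr0n // ler1n.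
have Bd x n : x \in F n -> 0 <= B n x x <= `|k x x| + 1.
  move=> xn; have [_ p0 pB h] := H n; have b0 := real_pd_diag x pB.
  rewrite b0 /=; have := le_trans (h x x xn xn) (n1 n).
  rewrite /splitting p0 ler_norml => /andP[_].
  have := ler_norm (k x x); lra.
have cB x y : B n x y @[n --> free_ultra] --> ulim (fun n => B n x y).
  apply: (@cvg_ulim _ _ (`|k x x| + `|k y y| + 2)).
  apply: filterS (hF2 x y) => n [xn yn]; have [_ _ pB _] := H n.
  have /andP[_ bx] := Bd _ _ xn; have /andP[_ by_] := Bd _ _ yn.
  have := real_pd_bound x y pB; have := normr_ge0 (B n x y); lra.
have cp x y : p n x y @[n --> free_ultra] --> ulim (fun n => p n x y).
  apply: (@cvg_ulim _ _ (`|k x y| + 1)).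
  apply: filterS (hF2 x y) => n [xn yn]; have [cp p0 pB h] := H n.
  have := real_pd_bound x y pB; rewrite (ger0_norm (real_cnd_ge0 x y cp p0)).
  have := le_trans (h x y xn yn) (n1 n).
  rewrite /splitting ler_norml => /andP[_].
  have := ler_norm (k x y); have := ler_norm (- B n x y); rewrite normrN; lra.
have cq (f : nat -> X -> X -> R) g r :
    (forall x y, f n x y @[n --> free_ultra] --> g x y) ->
    qform r (f n) @[n --> free_ultra] --> qform r g.
  move=> fg; apply: cvg_bsum => a _.
  apply: (@cvg_bsum _ _ _ r (fun b n => a.1 * b.1 * f n a.2 b.2)) => b _.
  by apply: cvgM => //; exact: cvg_cst.
exists (fun x y => ulim (fun n => p n x y)), (fun x y => ulim (fun n => B n x y)).
split.
- split=> [x y|r r0].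
    by congr ulim; apply/funext => n; have [[-> _]] := H n.
  apply: (cvgr_to_le (cq _ _ r cp)); apply: nearW => n.
  by have [[_ ->]] := H n.
- move=> x; apply: cvg_lim => //.
  by apply: cvg_near_cst; apply: nearW => n; have [_ ->] := H n.
- split=> [x y|r].
    by congr ulim; apply/funext => n; have [_ _ [-> _]] := H n.
  apply: (cvgr_to_ge (cq _ _ r cB)); apply: nearW => n.
  by have [_ _ [_ ->]] := H n.
move=> x y; set L := splitting _ _ x y.
have cL : `|splitting (p n) (B n) x y - k x y| @[n --> free_ultra] --> `|L - k x y|.
  apply: cvg_norm; apply: cvgB; last exact: cvg_cst.
  apply: cvgD; last by apply: cvgM => //; exact: cvg_cst.
  by apply: cvgD => //; apply: cvgD.
have cH : (n.+1%:R : R)^-1 @[n --> free_ultra] --> (0 : R).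
  apply: cvg_trans (@cvg_harmonic R).
  by move=> A; exact: near_free_ultra.
have : `|L - k x y| <= 0.
  apply: (ler_cvg_to cL cH); apply: near_free_ultra.
  by apply: filterS (hF2 x y) => n [xn yn]; have [_ _ _ ->] := H n.
by rewrite normr_le0 subr_eq0 => /eqP.
Qed.

End Derivative.

Lemma B2_norm_le1_contractive (R : realType) (G : groupType) (phi : G -> R[i]) :
  B2_norm_le phi 1%E -> schur_contractive (group_kernel phi).
Proof.
move=> [hs hn] A An.
have bA : bounded_op A by exists 1 => v; rewrite mul1r.
have [B [bB Bk]] := hs A bA; exists B; split => //.
apply/(opnorm_le1P bB); apply: le_trans hn; apply: ereal_sup_ubound.
by exists A, B; split => //; apply/(opnorm_le1P bA).
Qed.

Lemma splitting_of_contractive_semigroup (R : realType) (G : groupType)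
    (phi : G -> R) : countable [set: G] -> symmetric_fun phi ->
  (forall t : R, 0 < t -> B2_norm_le (fun x : G => (expR (- t * phi x))%:C) 1%E) ->
  exists psi theta : G -> G -> R[i],
     [/\ conditionally_negative_definite psi,
         (forall x : G, psi x x = 0),
         positive_definite theta,
         bounded_kernel theta &
         forall x y : G,
           (phi (y^-1 * x)%g)%:C = psi x y + theta x y + theta 1%g 1%g].
Proof.
move=> cG sphi hphi; have [F FP] := exhausting_exists cG; have [uF _] := FP.
pose k (x y : G) := phi (y^-1 * x)%g.
have sk x y : k x y = k y x by rewrite /k -sphi invgM invgK.
have fin n : exists p B, [/\ real_cnd p, forall x, p x x = 0, real_pd B &
     forall x y, x \in F n -> y \in F n ->
       `|splitting p B x y - k x y| <= n.+1%:R^-1].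
  apply: finite_splitting => //.
  move=> W bW; apply: (balanced_pairing_ge0 FP) => // t t0.
  exact: (B2_norm_le1_contractive (hphi t t0)).
have [p [B [cp p0 pB kE]]] := splitting_limit FP fin.
have Bx x : 4 * B x x = phi 1%g.
  have := kE x x; rewrite /k mulVg /splitting p0 => <-; ring.
exists (fun x y => (p x y)%:C), (fun x y => (2 * B x y)%:C); split.
- exact: real_cnd_complex.
- by move=> x; rewrite p0.
- by apply: real_pd_complex; exact: real_pdZ.
- exists (phi 1%g) => x y; rewrite /normc /= expr0n addr0 sqrtr_sqr normrM.
  rewrite normr_nat; apply: (le_trans (real_pd_bound x y pB)).
  have := Bx x; have := Bx y; have := real_pd_diag x pB; lra.
move=> x y; rewrite -!rmorphD /=; congr (_ %:C).
rewrite -/(k x y) -kE /splitting.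
have := Bx x; have := Bx y; have := Bx 1%g; lra.
Qed.

(** * Gram representation on a finite set *)

Section Gram.
Variables (R : realType) (X : eqType).
Implicit Types k : X -> X -> R.

Lemma real_pd_null_row k x y : real_pd k -> k x x = 0 -> k x y = 0.
Proof.
move=> [sk pk] k0; apply/eqP; apply: contraT => kn.
have := pk [:: (- (k y y + 1) / (2 * k x y), x); (1, y)].
rewrite /qform !big_cons !big_nil /= !addr0 k0 (sk y x).
set c := - _ / _; have : c * k x y = - (k y y + 1) / 2 by rewrite /c; field.
rewrite !mulr1 !mul1r; lra.
Qed.

(** Completing the square: the form of the complement is the form of k on the same
family enlarged by x0, with the weight that minimizes it.  When k x0 x0 = 0 the
subtracted term is 0, as the inverse of 0 is 0. *)
Lemma real_pd_schur_complement k x0 : real_pd k ->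
  real_pd (fun x y => k x y - k x x0 * k y x0 / k x0 x0).
Proof.
move=> pdk; have [sk pk] := pdk; split=> [x y|r];
  first by rewrite (sk x y) [k x x0 * _]mulrC.
pose m := k x0 x0; pose S := \sum_(a <- r) a.1 * k a.2 x0.
have -> : qform r (fun x y => k x y - k x x0 * k y x0 / k x0 x0) =
    qform r k - m^-1 * (S * S).
  rewrite -mulNr -(qform_prod r (k^~ x0) (k^~ x0)) -qformZ -qformD.
  congr (qform r _).
  by apply/funext => x; apply/funext => y; rewrite /m; ring.
have [m0|m0] := eqVneq m 0; first by rewrite m0 invr0 mul0r subr0.
have := pk ((- S / m, x0) :: r).
rewrite /qform big_cons /= big_cons /=.
under [X in _ + X]eq_bigr do rewrite big_cons /=.
rewrite big_split /= -/(qform r k) -/m.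
have -> : \sum_(j <- r) - S / m * j.1 * k x0 j.2 = - S / m * S.
  by rewrite [RHS]mulr_sumr; apply: eq_bigr => a _; rewrite (sk x0) mulrA.
have -> : \sum_(i <- r) i.1 * (- S / m) * k i.2 x0 = - S / m * S.
  by rewrite [RHS]mulr_sumr; apply: eq_bigr => a _; rewrite (mulrC a.1) mulrA.
move=> h; apply: (le_trans h); rewrite le_eqVlt; apply/orP; left; apply/eqP.
by field.
Qed.

(** Cholesky factorization: each point of s contributes one rank-one kernel, after
which the remainder is positive definite and vanishes on the row of that
point. *)
Lemma real_pd_gram k (s : seq X) : real_pd k -> exists fs : seq (X -> R),
  forall x y, x \in s -> k x y = \sum_(f <- fs) f x * f y.
Proof.
move=> pk.
suff [fs [_ h]] : exists fs : seq (X -> R),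
    real_pd (fun x y => k x y - \sum_(f <- fs) f x * f y) /\
    forall x y, x \in s -> k x y - \sum_(f <- fs) f x * f y = 0.
  by exists fs => x y xs; apply/eqP; rewrite -subr_eq0 h.
elim: s => [|x0 s [fs [pd h]]].
  exists [::]; split => //.
  rewrite (_ : (fun x y => _) = k) //; apply/funext => x; apply/funext => y.
  by rewrite big_nil subr0.
set k' := (fun x y => _) in pd; have hk' x y : x \in s -> k' x y = 0 := @h x y.
pose f0 x := k' x x0 / Num.sqrt (k' x0 x0).
have kE x y : k x y - \sum_(f <- f0 :: fs) f x * f y =
    k' x y - k' x x0 * k' y x0 / k' x0 x0.
  rewrite big_cons opprD addrCA addrC /k' -/(k' x y); congr (_ - _).
  rewrite /f0 mulrACA -invfM -expr2 sqr_sqrtr //; exact: real_pd_diag.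
exists (f0 :: fs); split=> [|x y].
  rewrite (_ : (fun x y => _) = (fun x y => k' x y - k' x x0 * k' y x0 / k' x0 x0)).
    exact: real_pd_schur_complement.
  by apply/funext => x; apply/funext => y; exact: kE.
rewrite kE in_cons => /orP[/eqP->|xs]; last first.
  by rewrite !(hk' x) // !mul0r subr0.
have [m0|m0] := eqVneq (k' x0 x0) 0.
  by rewrite m0 mul0r mul0r (real_pd_null_row _ pd m0) subr0.
have [sk _] := pd; rewrite (sk y x0); field; exact: m0.
Qed.

End Gram.

(** * Schur bounds on a finite set *)

Section SchurBounds.
Variables (R : realType) (X : eqType).
Implicit Types (s : seq X) (k : X -> X -> R) (c : R) (a : X -> X -> R[i]).

(** When s has no repetitions: Schur multiplication by the block of k on s has norm
at most c on matrices indexed by s. *)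
Definition schur_le s k c := forall a M, 0 <= M -> form_le s a M ->
  form_le s (fun x y => (k x y)%:C * a x y) (c * M).

Lemma eq_schur_le s k k' c : (forall x y, x \in s -> y \in s -> k x y = k' x y) ->
  schur_le s k c -> schur_le s k' c.
Proof.
move=> kk' h a M M0 aM u v.
rewrite (_ : bform s _ u v = bform s (fun x y => (k x y)%:C * a x y) u v).
  exact: h.
apply: eq_big_seq => x xs; apply: eq_big_seq => y ys; by rewrite kk'.
Qed.

Lemma schur_leM s k k' c c' : 0 <= c' -> schur_le s k c -> schur_le s k' c' ->
  schur_le s (fun x y => k x y * k' x y) (c * c').
Proof.
move=> c0 h h' a M M0 aM; rewrite -mulrA.
have := h _ _ (mulr_ge0 c0 M0) (h' a M M0 aM).
rewrite (_ : (fun x y => (k x y)%:C * ((k' x y)%:C * a x y)) =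
  (fun x y => (k x y * k' x y)%:C * a x y)) //.
by apply/funext => x; apply/funext => y; rewrite mulrA -rmorphM.
Qed.

Lemma schur_leX s k c n : 0 <= c -> schur_le s k c ->
  schur_le s (fun x y => k x y ^+ n) (c ^+ n).
Proof.
move=> c0 h; elim: n => [|n IH].
  move=> a M M0 aM; rewrite expr0 mul1r.
  rewrite (_ : (fun x y => _) = a) //; apply/funext => x; apply/funext => y.
  by rewrite expr0 mul1r.
rewrite exprS (_ : (fun x y => _) = (fun x y => k x y * k x y ^+ n)).
  by apply: schur_leM => //; exact: exprn_ge0.
by apply/funext => x; apply/funext => y; rewrite exprS.
Qed.

Lemma schur_leD s k k' c c' : schur_le s k c -> schur_le s k' c' ->
  schur_le s (fun x y => k x y + k' x y) (c + c').
Proof.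
move=> h h' a M M0 aM u v.
have -> : bform s (fun x y => (k x y + k' x y)%:C * a x y) u v =
  bform s (fun x y => (k x y)%:C * a x y) u v +
  bform s (fun x y => (k' x y)%:C * a x y) u v.
  rewrite /bform -big_split; apply: eq_bigr => x _ /=.
  by rewrite -big_split; apply: eq_bigr => y _ /=; rewrite rmorphD; ring.
rewrite Re_add !mulrDl; apply: lerD; [exact: h | exact: h'].
Qed.

(** The easy half of the Grothendieck-Haagerup characterization: multiplying a by
f(x) g(y) amounts to evaluating the form of a at the vectors g u and f v, and the
squared norms of these add up. *)
Lemma schur_le_factor s k c (fgs : seq ((X -> R) * (X -> R))) :
  (forall x y, x \in s -> y \in s -> k x y = \sum_(p <- fgs) p.1 x * p.2 y) ->
  (forall x, x \in s -> \sum_(p <- fgs) p.1 x ^+ 2 <= c) ->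
  (forall y, y \in s -> \sum_(p <- fgs) p.2 y ^+ 2 <= c) ->
  schur_le s k c.
Proof.
move=> kE hf hg a M M0 aM u v.
pose w (f : X -> R) (u : X -> R[i]) x := (f x)%:C * u x.
have -> : bform s (fun x y => (k x y)%:C * a x y) u v =
    \sum_(p <- fgs) bform s a (w p.2 u) (w p.1 v).
  rewrite /bform [RHS]exchange_big; apply: eq_big_seq => x xs.
  rewrite [RHS]exchange_big; apply: eq_big_seq => y ys.
  rewrite kE // rmorph_sum !mulr_suml; apply: eq_bigr => p _.
  by rewrite /w rmorphM; ring.
rewrite Re_sum.
apply: (@le_trans _ _ (\sum_(p <- fgs) M / 2 * (l2sq s (w p.2 u) + l2sq s (w p.1 v)))).
  by apply: ler_sum => p _; exact: aM.
rewrite -mulr_sumr.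
have -> : c * M / 2 * (l2sq s u + l2sq s v) = M / 2 * (c * (l2sq s u + l2sq s v)).
  by ring.
apply: ler_wpM2l; first by rewrite divr_ge0.
rewrite big_split mulrDr /=.
have l2le (z : X -> R[i]) (f : (X -> R) * (X -> R) -> X -> R) :
    (forall x, x \in s -> \sum_(p <- fgs) f p x ^+ 2 <= c) ->
    \sum_(p <- fgs) l2sq s (w (f p) z) <= c * l2sq s z.
  move=> fc; rewrite /l2sq exchange_big mulr_sumr big_seq [leRHS]big_seq.
  apply: ler_sum => x xs; under eq_bigr do rewrite nsqM nsq_real.
  by rewrite -mulr_suml ler_wpM2r ?nsq_ge0 // fc.
by apply: lerD; apply: l2le.
Qed.

Lemma form_le_entry s a M x y (z w : R[i]) : uniq s -> form_le s a M ->
  x \in s -> y \in s -> `|Re (a x y * z * w)| <= M / 2 * (nsq z + nsq w).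
Proof.
move=> us aM xs ys.
have h w' : Re (a x y * z * w') <= M / 2 * (nsq z + nsq w').
  have := aM (fun y' => if y' == y then z else 0) (fun x' => if x' == x then w' else 0).
  rewrite /bform /l2sq (big_seq_support1 us xs) => [|x' /negbTE ->]; last first.
    by rewrite big1 // => y' _; exact: mulr0.
  rewrite (big_seq_support1 us ys) => [|y' /negbTE ->]; last by rewrite mulr0 mul0r.
  rewrite (big_seq_support1 us ys) => [|y' /negbTE ->]; last by rewrite nsq0.
  rewrite (big_seq_support1 us xs) => [|x' /negbTE ->]; last by rewrite nsq0.
  by rewrite !eqxx.
rewrite ler_norml h andbT; have := h (- w).
by rewrite mulrN Re_opp nsqN lerNl.
Qed.

(** A crude bound, enough for remainders of second order in t: each entry of a is
bounded by M. *)
Lemma schur_le_small s k c : uniq s -> 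
  (forall x y, x \in s -> y \in s -> `|k x y| <= c) ->
  schur_le s k (c * (size s)%:R).
Proof.
move=> us kc a M M0 aM u v.
have card (z : R) : \sum_(y <- s) z = (size s)%:R * z.
  by rewrite big_const_seq count_predT iter_addr_0 mulr_natl.
have -> : c * (size s)%:R * M / 2 * (l2sq s u + l2sq s v) =
  dsum s (fun x y => c * (M / 2 * (nsq (u y) + nsq (v x)))).
  rewrite dsumZ dsumZ dsumD.
  have -> : dsum s (fun _ y => nsq (u y)) = (size s)%:R * l2sq s u by exact: card.
  have -> : dsum s (fun x _ => nsq (v x)) = (size s)%:R * l2sq s v.
    by rewrite /dsum mulr_sumr; apply: eq_bigr => x _; exact: card.
  by ring.
rewrite /bform Re_sum.
have -> : \sum_(x <- s) Re (\sum_(y <- s) (k x y)%:C * a x y * u y * v x) =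
  dsum s (fun x y => k x y * Re (a x y * u y * v x)).
  apply: eq_bigr => x _; rewrite Re_sum; apply: eq_bigr => y _.
  by rewrite -!mulrA Re_realM.
apply: ler_dsum => x y xs ys; apply: (le_trans (ler_norm _)).
by rewrite normrM ler_pM // ?kc //; exact: (form_le_entry _ _ us aM).
Qed.

End SchurBounds.

(** * From a splitting to a contractive semigroup *)

Section Semigroup.
Variables (R : realType) (X : eqType).
Implicit Types (s : seq X) (k psi theta : X -> X -> R).

(** Adjoin e to the family, with the weight that makes the total weight zero. *)
Lemma real_cnd_pd psi e : real_cnd psi -> (forall x, psi x x = 0) ->
  real_pd (fun x y => psi x e + psi y e - psi x y).
Proof.
move=> [sk ck] p0; split=> [x y|r]; first by rewrite (sk x y); ring.
pose S := \sum_(a <- r) a.1; pose T := \sum_(a <- r) a.1 * psi a.2 e.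
have -> : qform r (fun x y => psi x e + psi y e - psi x y) =
    T * S + S * T - qform r psi.
  rewrite (_ : (fun x y => _) =
    (fun x y => (psi x e * 1 + 1 * psi y e) + -1 * psi x y)); last first.
    by apply/funext => x; apply/funext => y; ring.
  rewrite 2!qformD (qform_prod r (psi^~ e) (fun=> 1)).
  rewrite (qform_prod r (fun=> 1) (psi^~ e)) qformZ mulN1r -/T.
  by have -> : \sum_(a <- r) a.1 * 1 = S by apply: eq_bigr => a _; rewrite mulr1.
have := ck ((- S, e) :: r); rewrite big_cons /= addNr => /(_ erefl).
rewrite /qform big_cons /= big_cons /=.
under [X in _ + X]eq_bigr do rewrite big_cons /=.
rewrite big_split /= -/(qform r psi) p0.
have -> : \sum_(j <- r) - S * j.1 * psi e j.2 = - S * T.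
  by rewrite [RHS]mulr_sumr; apply: eq_bigr => a _; rewrite (sk e) mulrA.
have -> : \sum_(i <- r) i.1 * - S * psi i.2 e = - S * T.
  by rewrite [RHS]mulr_sumr; apply: eq_bigr => a _; rewrite (mulrC a.1) mulrA.
lra.
Qed.

(** First-order approximation of e^{-tk} for k = psi + theta + c.  The factors of
theta enter with opposite signs on the two sides, which produces - t theta in the
kernel but + t theta in the norms; on the diagonal the contributions of order t
cancel: - 2 t psi(x, e) - t c from the scalar factor, 2 t psi(x, e) and t c from
the two Gram kernels. *)
Lemma schur_le_generator s psi theta (c t : R) e :
  real_cnd psi -> (forall x, psi x x = 0) -> real_pd theta ->
  (forall x, theta x x = c) -> 0 <= t ->
  let g x := psi x e + c / 2 in
  schur_le s (fun x y => 1 - t * (psi x y + theta x y + c) + t ^+ 2 * (g x * g y))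
    (1 + t ^+ 2 * \sum_(x <- s) g x ^+ 2).
Proof.
move=> cp p0 pt tc t0 g.
have [fs fsE] := real_pd_gram s (real_cnd_pd e cp p0).
have [hs hsE] := real_pd_gram s pt.
pose q := Num.sqrt t; have qq : q * q = t by rewrite -expr2 sqr_sqrtr.
pose f0 x := 1 - t * g x.
pose fgs : seq ((X -> R) * (X -> R)) := (f0, f0) ::
  [seq ((fun x => q * f x), (fun x => q * f x)) | f <- fs] ++
  [seq ((fun x => q * h x), (fun x => - (q * h x))) | h <- hs].
have diag x : x \in s -> f0 x ^+ 2 + (t * \sum_(f <- fs) f x * f x
    + t * \sum_(h <- hs) h x * h x) <= 1 + t ^+ 2 * \sum_(x <- s) g x ^+ 2.
  move=> xs; rewrite -fsE // -hsE // p0 tc.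
  have -> : f0 x ^+ 2 + (t * (psi x e + psi x e - 0) + t * c) = 1 + t ^+ 2 * g x ^+ 2.
    by rewrite /f0 /g; field.
  rewrite lerD2l ler_wpM2l ?sqr_ge0 // (big_rem x) //= lerDl.
  by apply: sumr_ge0 => y _; exact: sqr_ge0.
apply: (@schur_le_factor _ _ _ _ _ fgs).
- move=> x y xs ys; rewrite big_cons big_cat !big_map /=.
  under [X in _ + (X + _)]eq_bigr do rewrite mulrACA qq.
  under [X in _ + (_ + X)]eq_bigr do rewrite mulrN mulrACA qq.
  rewrite sumrN -!mulr_sumr -fsE // -hsE // /f0 /g; by field.
- move=> x xs; rewrite big_cons big_cat !big_map /=.
  under [X in _ + (X + _)]eq_bigr do rewrite expr2 mulrACA qq.
  under [X in _ + (_ + X)]eq_bigr do rewrite expr2 mulrACA qq.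
  by rewrite -!mulr_sumr diag.
- move=> x xs; rewrite big_cons big_cat !big_map /=.
  under [X in _ + (X + _)]eq_bigr do rewrite expr2 mulrACA qq.
  under [X in _ + (_ + X)]eq_bigr do rewrite sqrrN expr2 mulrACA qq.
  by rewrite -!mulr_sumr diag.
Qed.

(** The remainder e^{-tk} - 1 + t k is of second order on the finite set s, with a
constant that depends on s. *)
Lemma schur_le_small_time s psi theta (c : R) (e : X) :
  uniq s -> real_cnd psi -> (forall x, psi x x = 0) -> real_pd theta ->
  (forall x, theta x x = c) ->
  exists C t0 : R, [/\ 0 <= C, 0 < t0 & forall t, 0 <= t <= t0 ->
    schur_le s (fun x y => expR (- t * (psi x y + theta x y + c))) (1 + t ^+ 2 * C)].
Proof.
move=> us cp p0 pt tc.
pose k x y := psi x y + theta x y + c.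
pose g x := psi x e + c / 2.
pose K := dsum s (fun x y => `|k x y|).
have K0 : 0 <= K by apply: sumr_ge0 => x _; apply: sumr_ge0.
have kK x y : x \in s -> y \in s -> `|k x y| <= K.
  exact: (@dsum_ge_term _ _ s (fun x y => `|k x y|)).
pose L := dsum s (fun x y => `|g x * g y|).
have L0 : 0 <= L by apply: sumr_ge0 => x _; apply: sumr_ge0.
have gL x y : x \in s -> y \in s -> `|g x * g y| <= L.
  exact: (@dsum_ge_term _ _ s (fun x y => `|g x * g y|)).
pose S := \sum_(x <- s) g x ^+ 2.
have S0 : 0 <= S by apply: sumr_ge0 => x _; exact: sqr_ge0.
exists (S + (2 * K ^+ 2 + L) * (size s)%:R), (2 * (K + 1))^-1; split.
- by rewrite addr_ge0 // mulr_ge0 // addr_ge0 // mulr_ge0 // sqr_ge0.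
- by rewrite invr_gt0; lra.
move=> t /andP[t0 tle].
pose b x y := 1 - t * k x y + t ^+ 2 * (g x * g y).
have -> : 1 + t ^+ 2 * (S + (2 * K ^+ 2 + L) * (size s)%:R) =
  (1 + t ^+ 2 * S) + (t ^+ 2 * (2 * K ^+ 2 + L)) * (size s)%:R by ring.
apply: (@eq_schur_le _ _ _ (fun x y => b x y + (expR (- t * k x y) - b x y))).
  by move=> x y _ _; rewrite addrC subrK.
apply: schur_leD; first exact: schur_le_generator.
apply: schur_le_small => // x y xs ys.
have zle : `|- t * k x y| <= 2^-1.
  rewrite normrM normrN (ger0_norm t0).
  apply: (@le_trans _ _ ((2 * (K + 1))^-1 * K)).
    by apply: ler_pM => //; exact: kK.
  rewrite mulrC ler_pdivrMr; lra.
have /andP[h1 h2] := expR_taylor1 zle.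
have -> : expR (- t * k x y) - b x y =
  (expR (- t * k x y) - 1 - (- t * k x y)) - t ^+ 2 * (g x * g y) by rewrite /b; ring.
apply: (le_trans (ler_normB _ _)); rewrite ger0_norm // [leRHS]mulrDr; apply: lerD.
  apply: (le_trans h2); rewrite exprMn sqrrN mulrCA ler_wpM2l ?sqr_ge0 //.
  rewrite ler_wpM2l // -[k x y ^+ 2]real_normK ?num_real //.
  by rewrite ler_pXn2r ?nnegrE ?normr_ge0 ?kK.
by rewrite normrM ger0_norm ?sqr_ge0 // ler_wpM2l ?sqr_ge0 ?gL.
Qed.

(** The n-th power of the bound at time t / n is at most exp(t^2 C / n), which tends
to 1: the dependence of C on s disappears. *)
Lemma schur_le_semigroup s psi theta (c t : R) (e : X) :
  uniq s -> real_cnd psi -> (forall x, psi x x = 0) -> real_pd theta ->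
  (forall x, theta x x = c) -> 0 < t ->
  schur_le s (fun x y => expR (- t * (psi x y + theta x y + c))) 1.
Proof.
move=> us cp p0 pt tc t0.
have [C [d [C0 d0 hC]]] := schur_le_small_time e us cp p0 pt tc.
move=> a M M0 aM u v.
set Z := Re _; set Y := l2sq s u + l2sq s v.
have Y0 : 0 <= Y by rewrite addr_ge0 ?l2sq_ge0.
have harm : (n.+1%:R : R)^-1 @[n --> \oo] --> (0 : R) by exact: cvg_harmonic.
have small (w r : R) : 0 < r -> \forall n \near \oo, w * n.+1%:R^-1 <= r.
  move=> r0; have cv : w * n.+1%:R^-1 @[n --> \oo] --> (0 : R).
    by rewrite -(mulr0 w); apply: cvgM => //; exact: cvg_cst.
  exact: (cvgr_le _ cv _ r0).
have cvY : (1 + 2 * (t ^+ 2 * C * n.+1%:R^-1)) * (M / 2 * Y) @[n --> \oo] -->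
    (1 + 2 * (t ^+ 2 * C * 0)) * (M / 2 * Y).
  apply: cvgM; last exact: cvg_cst.
  apply: cvgD; first exact: cvg_cst.
  apply: cvgM; first exact: cvg_cst.
  by apply: cvgM => //; exact: cvg_cst.
rewrite mul1r; have -> : M / 2 * Y = (1 + 2 * (t ^+ 2 * C * 0)) * (M / 2 * Y) by ring.
apply: (cvgr_to_ge cvY).
have half0 : (0 : R) < 2^-1 by rewrite invr_gt0.
apply: filterS2 (small t d d0) (small (t ^+ 2 * C) _ half0) => n nd nh.
set N : R := n.+1%:R; have N0 : 0 < N by rewrite ltr0n.
have tn : 0 <= t / N <= d by rewrite nd andbT; apply: divr_ge0; exact: ltW.
have cn0 : 0 <= 1 + (t / N) ^+ 2 * C by rewrite addr_ge0 // mulr_ge0 // sqr_ge0.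
have := schur_leX n.+1 cn0 (hC _ tn).
have -> : (fun x y => expR (- (t / N) * (psi x y + theta x y + c)) ^+ n.+1) =
   (fun x y => expR (- t * (psi x y + theta x y + c))).
  apply/funext => x; apply/funext => y; rewrite -expRM_natl; congr expR.
  by rewrite -/N; field; rewrite gt_eqF.
move=> /(_ a M M0 aM u v); rewrite -/Z -/Y => h; apply: (le_trans h).
rewrite (_ : _ * M / 2 * Y = (1 + (t / N) ^+ 2 * C) ^+ n.+1 * (M / 2 * Y));
  last by rewrite !mulrA.
apply: ler_wpM2r; first by rewrite mulr_ge0 // divr_ge0.
pose z := t ^+ 2 * C / N.
have z0 : 0 <= z by rewrite divr_ge0 ?mulr_ge0 ?sqr_ge0 // ltW.
have zh : `|z| <= 2^-1 by rewrite ger0_norm.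
have le1 : (1 + (t / N) ^+ 2 * C) ^+ n.+1 <= expR z.
  have -> : z = n.+1%:R * ((t / N) ^+ 2 * C).
    by rewrite -/N /z; field; rewrite gt_eqF.
  rewrite expRM_natl; apply: lerXn2r; rewrite ?nnegrE ?expR_ge0 //.
  exact: expR_ge1Dx.
apply: (le_trans le1); have /andP[_] := expR_taylor1 zh.
rewrite -/z.
have : z ^+ 2 <= z * 2^-1.
  by rewrite expr2 ler_wpM2l // -(ger0_norm z0).
lra.
Qed.

End Semigroup.

(** * The theorem *)

Lemma schur_norm_le1 (R : realType) (X : choiceType) (k : X -> X -> R) :
  countable [set: X] -> (forall s, uniq s -> schur_le s k 1) ->
  schur_multiplier (fun x y => (k x y)%:C) /\
  (schur_norm (fun x y => (k x y)%:C) <= 1)%E.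
Proof.
move=> cX hk; have [F FP] := exhausting_exists cX; split.
  move=> A [M AM]; pose K := `|M| + 1.
  have K0 : 0 < K by rewrite ltr_wpDl.
  have AK v : norm2 (A v) <= K * norm2 v.
    apply: (le_trans (AM v)); rewrite ler_wpM2r ?norm2_ge0 //.
    by apply: (le_trans (ler_norm M)); rewrite lerDl.
  have form s : uniq s -> form_le s (fun x y => (k x y)%:C * op_matrix A x y) K.
    by move=> us; have := hk s us _ _ (ltW K0) (op_form_le K0 AK us); rewrite mul1r.
  have [B [Bn Bk]] := matrix_operator FP K0 form.
  by exists B; split => //; exists K.
apply: ge_ereal_sup => _ [A [B [bA An [bB Bk] ->]]].
have {}An := (opnorm_le1P bA).1 An.
have A1 v : norm2 (A v) <= 1 * norm2 v by rewrite mul1r.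
apply/(opnorm_le1P bB) => v; rewrite -[leRHS]mul1r.
apply: (operator_le_of_matrix FP) => // s us.
have := hk s us _ _ ler01 (op_form_le ltr01 A1 us); rewrite mulr1.
rewrite (_ : (fun x y => _) = op_matrix B) //.
by apply/funext => x; apply/funext => y; rewrite Bk.
Qed.

Theorem theorem1p4 (R : realType) (G : groupType)
    (G_countable : countable [set: G])
    (phi : G -> R) (phi_sym : symmetric_fun phi) :
  (forall t : R, 0 < t ->
     B2_norm_le (fun x : G => (expR (- t * phi x))%:C) 1%E)
  <->
  (exists psi theta : G -> G -> R[i],
     [/\ conditionally_negative_definite psi,
         (forall x : G, psi x x = 0),
         positive_definite theta,
         bounded_kernel theta &
         forall x y : G,
           (phi (y^-1 * x)%g)%:C = psi x y + theta x y + theta 1%g 1%g]).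
Proof.
split; first exact: splitting_of_contractive_semigroup.
move=> [psi [theta [cp p0 pt _ phiE]]] t t0.
pose p x y := Re (psi x y); pose th x y := Re (theta x y).
pose c := th 1%g 1%g.
have kE x y : phi (y^-1 * x)%g = p x y + th x y + c.
  have := congr1 Re (phiE x y).
  by rewrite !Re_add.
have rp : real_cnd p := Re_cnd cp.
have rp0 x : p x x = 0 by rewrite /p p0.
have rt : real_pd th.
  split=> [x y|r]; last exact: Re_positive_definite.
  have := kE x y; rewrite -phi_sym invgM invgK kE; have [-> _] := rp; lra.
have tc x : th x x = c.
  have := kE x x; have := kE 1%g 1%g; rewrite !mulVg !rp0 -/c; lra.
apply: schur_norm_le1 => // s us.
rewrite (_ : (fun x y => _) = (fun x y => expR (- t * (p x y + th x y + c)))).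
  exact: (schur_le_semigroup 1%g).
by apply/funext => x; apply/funext => y; rewrite kE.
Qed.
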